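(* Let $d\in\mathbb{N}$ and $\sigma\in(0,\min\{1,d/2\})$. Let $V:\mathbb{Z}^d\to\mathbb{R}$ with $V\le1$ be such that the fractional Schrödinger operator $\Delta^\sigma+V$ is positive. Let $u:\mathbb{Z}^d\to\mathbb{R}$ be harmonic for $\Delta^\sigma+V$. If $u(x)=O(|x|^{\sigma-d/2})$ as $|x|\to\infty$ and $\liminf_{|x|\to\infty}|u(x)|\,|x|^{d+2\sigma}=0$, then $u=0$.
   Context: For $f:\mathbb{Z}^d\to\mathbb{R}$ let $\Delta f(x)=\sum_{y:|y-x|=1}(f(x)-f(y))$ ($|\cdot|$ Euclidean norm), with heat semigroup $e^{-t\Delta}$ on $\ell^2(\mathbb{Z}^d)$; $1_0$ is the indicator of $\{0\}$. For $\sigma\in(0,1)$ the Riesz kernel is $\kappa_\sigma(0)=0$ and $\kappa_\sigma(x)=\frac{1}{|\Gamma(-\sigma)|}\int_0^\infty e^{-t\Delta}1_0(x)\,\frac{dt}{t^{1+\sigma}}$ for $x\ne0$. The fractional Laplacian acts on functions $f$ with $\sum_y\kappa_\sigma(x-y)|f(y)|<\infty$ for all $x$ by $\Delta^\sigma f(x)=\sum_y\kappa_\sigma(x-y)(f(x)-f(y))$ (on $\ell^2$ this coincides with the spectral-theoretic power of $\Delta$). The operator $\Delta^\sigma+V$ is called positive if its quadratic form on $\ell^2(\mathbb{Z}^d)$ is nonnegative, i.e. $\langle\Delta^\sigma\varphi,\varphi\rangle+\sum_xV(x)\varphi(x)^2\ge0$ for all finitely supported $\varphi$. A function $u$ is harmonic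 for $\Delta^\sigma+V$ if $\Delta^\sigma u$ is defined and $\Delta^\sigma u(x)+V(x)u(x)=0$ for all $x\in\mathbb{Z}^d$. *)

(* Defs.v *)
From HB Require Import structures.
From mathcomp Require Import all_boot all_order all_algebra.
From mathcomp Require Import all_classical all_reals all_analysis.
Set Implicit Arguments. Unset Strict Implicit. Unset Printing Implicit Defensive.
Import Order.TTheory GRing.Theory Num.Theory.
Import numFieldNormedType.Exports.
Local Open Scope classical_set_scope.
Local Open Scope ring_scope.

Section FracLap.
Variables (R : realType) (d : nat).

Notation Zd := 'rV[int]_d.

Definition normZ (x : Zd) : R := Num.sqrt (\sum_(i < d) ((x 0 i)%:~R : R) ^+ 2).

Definition unitZ (i : 'I_d) : Zd := delta_mx 0 i.

(* Delta f(x) = sum_{|y-x|=1} (f x - f y); the y with |y-x|=1 are x +- e_i *)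
Definition lap (f : Zd -> R) (x : Zd) : R :=
  \sum_(i < d) ((f x - f (x + unitZ i)) + (f x - f (x - unitZ i))).

Definition lapn (n : nat) (f : Zd -> R) : Zd -> R := iter n lap f.

Definition ind0 (x : Zd) : R := if x == 0 then 1 else 0.

(* e^{-t Delta} 1_0 (x) : exponential series of the bounded operator Delta *)
Definition heat (t : R) (x : Zd) : R :=
  limn (fun M => \sum_(n < M) ((- t) ^+ n / (n`!)%:R * lapn n ind0 x)).

Definition Gamma (s : R) : R :=
  fine (\int[@lebesgue_measure R]_(t in `]0%R, +oo[) ((t `^ (s - 1)) * expR (- t))%:E)%E.

(* |Gamma(-sigma)| for sigma in (0,1), via Gamma(-sigma) = Gamma(1-sigma)/(-sigma) *)
Definition absGammaNeg (sigma : R) : R := Gamma (1 - sigma) / sigma.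

Definition kappa (sigma : R) (x : Zd) : R :=
  if x == 0 then 0 else
  (absGammaNeg sigma)^-1 *
  fine (\int[@lebesgue_measure R]_(t in `]0%R, +oo[)
          (heat t x * t `^ (- (1 + sigma)))%:E)%E.

Definition boxsum (N : nat) (g : Zd -> R) : R :=
  \sum_(k : {ffun 'I_d -> 'I_(N.*2.+1)}) g (\row_i ((k i)%:Z - N%:Z)).

Definition inbox (N : nat) (x : Zd) : Prop := forall i, `|x 0 i| <= N%:Z.

Definition frac_domain (sigma : R) (f : Zd -> R) : Prop :=
  forall x, exists M : R, forall N, boxsum N (fun y => `|kappa sigma (x - y) * f y|) <= M.

Definition fracLap (sigma : R) (f : Zd -> R) (x : Zd) : R :=
  limn (fun N => boxsum N (fun y => kappa sigma (x - y) * (f x - f y))).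

Definition frac_positive (sigma : R) (V : Zd -> R) : Prop :=
  forall (phi : Zd -> R) (N : nat), (forall x, ~ inbox N x -> phi x = 0) ->
    0 <= boxsum N (fun x => fracLap sigma phi x * phi x + V x * phi x ^+ 2).

Definition frac_harmonic (sigma : R) (V u : Zd -> R) : Prop :=
  frac_domain sigma u /\ forall x, fracLap sigma u x + V x * u x = 0.

Definition liminf_infty (g : Zd -> R) : \bar R :=
  ereal_sup [set ereal_inf [set (g x)%:E | x in [set x | r <= normZ x]] | r in [set: R]].

Definition bigO_infty (g h : Zd -> R) : Prop :=
  exists C r0 : R, forall x, r0 <= normZ x -> `|g x| <= C * `|h x|.

End FracLap.

Arguments normZ {R d}.
Arguments lap {R d}.
Arguments heat {R d}.
Arguments kappa {R d}.
Arguments boxsum {R d}.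
Arguments frac_domain {R d}.
Arguments fracLap {R d}.
Arguments frac_positive {R d}.
Arguments frac_harmonic {R d}.
Arguments liminf_infty {R d}.
Arguments bigO_infty {R d}.

(* Main.v *)
(* Kernel estimates: writing [e^{-t Delta} 1_0] as the law of a continuous-time walk,
   its second moment [2 d t] gives, uniformly in [r >= 1],
     [\sum_z kappa z * ln (1 + |z| / r) ^ 2 <= C r^{-2 sigma}],
   while a local lower bound for products of Poisson weights gives
   [kappa z >= c |z|^{-d - 2 sigma}]; no pointwise upper bound on [kappa] is needed.

   Sign: the cutoffs [phi_m = max (0, 1 - ln (1 + |x|) / ln 2^m)] have energy [O(1/m)]
   with respect to the weight [kappa (x - y) |u x| |u y|], because
   [|u x| = O(|x|^{sigma - d/2})].  Testing positivity with [|u| phi_m] and using the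
   ground state identity for [u] gives
     [0 <= (energy of phi_m) / 2
           - \sum kappa (x - y) (|u x u y| - u x u y) phi_m x phi_m y],
   so in the limit [u] has constant sign, as [kappa > 0] off the diagonal.

   Decay: for [u] of constant sign, [V <= 1] and harmonicity give
   [kappa (x - a) |u a| <= (1 + \sum kappa) |u x|], so [u a <> 0] would force
   [|u x| >= c |x|^{-d - 2 sigma}], contradicting the liminf hypothesis. *)
Require Import Defs.
From HB Require Import structures.
From mathcomp Require Import all_boot all_order all_algebra.
From mathcomp Require Import all_classical all_reals all_analysis.
From mathcomp Require Import ring lra zify measurable_realfun.
Set Implicit Arguments. Unset Strict Implicit. Unset Printing Implicit Defensive.
Import Order.TTheory GRing.Theory Num.Theory.
Import numFieldNormedType.Exports.
Local Open Scope classical_set_scope.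
Local Open Scope ring_scope.

(** * Finite sums over lattice boxes *)

Section LatticeSums.
Variables (R : realType) (d : nat).
Notation Zd := 'rV[int]_d.
Implicit Types (x y z : Zd) (g h : Zd -> R).

(** The decay assumed of [u] does not by itself put it in l^2, so positivity is tested only with
    truncations of [|u|], and the cost of truncating has to tend to 0. With [|u|] bounded at the
    point nearer the origin, a cutoff that is a function of [ln |x|] has its energy summed against
    [|x| ^ (2 sigma - d) * |x| ^ (- 2 sigma) = |x| ^ (- d)], whose sum over the ball of radius
    [2 ^ m] is of order [m]. Falling linearly in [ln |x|] over that range costs a squared slope of
    order [1 / m ^ 2], which leaves [1 / m]; a cutoff living on a single scale would only give a
    bounded energy.

    On the heat side the diagonal of Delta is split off, [exp (- t Delta) = exp (- 2 d t) * exp (t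
    A)] with [A] the sum of the [2 d] unit translations. All coefficients of [exp (t A) 1_0] are
    nonnegative, so every truncation of the series bounds it from below, while bounds uniform in the
    truncation pass to the limit. Nonnegative box sums, monotone in the box, play the role of sums
    over the lattice; distances are measured by [supn] because its balls are the boxes. *)

Definition supn x : nat := \max_(i < d) `|x 0%R i|%N.

Definition boxseq N : seq Zd :=
  [seq \row_i ((k i)%:Z - N%:Z) | k : {ffun 'I_d -> 'I_(N.*2.+1)}].

Lemma leq_supn x i : (`|x 0%R i|%N <= supn x)%N.
Proof. exact: (leq_bigmax i). Qed.

Lemma supn_leqP x N : reflect (forall i, (`|x 0%R i|%N <= N)%N) (supn x <= N)%N.
Proof.
apply: (iffP idP) => [h i|h]; first exact: leq_trans (leq_supn x i) h.
by apply/bigmax_leqP => i _.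
Qed.

Lemma inboxP N x : inbox N x <-> (supn x <= N)%N.
Proof.
split=> [h|/supn_leqP h i]; last by have := h i; lia.
by apply/supn_leqP => i; have := h i; lia.
Qed.

Lemma supnD x y : (supn (x + y) <= supn x + supn y)%N.
Proof.
apply/supn_leqP => i; rewrite mxE; have := leq_supn x i; have := leq_supn y i.
by move: (x 0 i) (y 0 i) => a b; lia.
Qed.

Lemma supnN x : supn (- x) = supn x.
Proof. by apply: eq_bigr => i _; rewrite mxE abszN. Qed.

Lemma supn0 : supn 0 = 0%N.
Proof. by apply/eqP; rewrite -leqn0; apply/supn_leqP => i; rewrite mxE. Qed.

Lemma supn_eq0 x : (supn x == 0%N) = (x == 0).
Proof.
apply/eqP/eqP => [h|->]; last exact: supn0.
apply/rowP => i; rewrite mxE; have := leq_supn x i; rewrite h; move: (x 0 i) => a; lia.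
Qed.

Lemma mem_boxseq N x : (x \in boxseq N) = (supn x <= N)%N.
Proof.
apply/mapP/supn_leqP => [[k _ ->] i|h].
  rewrite mxE; have := ltn_ord (k i); move: (nat_of_ord (k i)) => a; lia.
have lt i : (`|(x 0 i + N%:Z)%R|%N < N.*2.+1)%N by have := h i; move: (x 0 i) => a; lia.
exists [ffun i => Ordinal (lt i)]; first by rewrite mem_enum.
by apply/rowP => i; rewrite mxE ffunE /=; have := h i; move: (x 0 i) => a; lia.
Qed.

Lemma boxseq_uniq N : uniq (boxseq N).
Proof.
rewrite map_inj_uniq ?enum_uniq// => k l /rowP h; apply/ffunP => i.
by apply/val_inj; have := h i; rewrite !mxE /=; move: (nat_of_ord (k i)) (nat_of_ord (l i)) => a b; lia.
Qed.

Lemma size_boxseq N : size (boxseq N) = (N.*2.+1 ^ d)%N.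
Proof. by rewrite size_map -cardE card_ffun !card_ord. Qed.

Lemma boxsumE N g : boxsum N g = \sum_(x <- boxseq N) g x.
Proof. by rewrite /boxseq big_map /boxsum -big_enum. Qed.

Lemma ler_sum_seq_sub (T : eqType) (s t : seq T) (f : T -> R) :
  uniq s -> {subset s <= t} -> (forall i, 0 <= f i) ->
  \sum_(i <- s) f i <= \sum_(i <- t) f i.
Proof.
move=> us st f0.
have -> : \sum_(i <- s) f i = \sum_(i <- undup t | i \in s) f i.
  rewrite -[RHS]big_filter; apply: perm_big; apply: uniq_perm => //.
    by rewrite filter_uniq// undup_uniq.
  by move=> i; rewrite mem_filter mem_undup; case: (boolP (i \in s)) => // /st ->.
rewrite big_mkcond /=; apply: (@le_trans _ _ (\sum_(i <- undup t) f i)).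
  by apply: ler_sum => i _; case: ifP.
elim: t {st} => //= a t IH; rewrite big_cons; case: ifP => _.
  by rewrite (le_trans IH)// lerDr.
by rewrite big_cons lerD2l.
Qed.

Lemma boxsum_ge0 N g : (forall x, 0 <= g x) -> 0 <= boxsum N g.
Proof. by move=> h; apply: sumr_ge0. Qed.

Lemma eq_boxsum N g h : (forall x, g x = h x) -> boxsum N g = boxsum N h.
Proof. by move=> e; apply: eq_bigr. Qed.

Lemma ler_boxsum N g h : (forall x, (supn x <= N)%N -> g x <= h x) -> boxsum N g <= boxsum N h.
Proof.
move=> e; rewrite !boxsumE big_seq_cond [leRHS]big_seq_cond.
by apply: ler_sum => x; rewrite andbT mem_boxseq => /e.
Qed.

(** Box sums are not translation invariant. Enlarging the target box gives a one-sided substitute,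
    which is enough because all bounds below are uniform in the box. *)
Lemma boxsum_inj_le N M (f : Zd -> Zd) g : injective f ->
  (forall x, (supn x <= N)%N -> (supn (f x) <= M)%N) -> (forall x, 0 <= g x) ->
  boxsum N (fun x => g (f x)) <= boxsum M g.
Proof.
move=> fi fb g0; rewrite !boxsumE -(big_map f xpredT g).
apply: ler_sum_seq_sub => //; first by rewrite map_inj_uniq// boxseq_uniq.
by move=> _ /mapP[x + ->]; rewrite !mem_boxseq => /fb.
Qed.

Lemma boxsum_mono N M g : (N <= M)%N -> (forall x, 0 <= g x) -> boxsum N g <= boxsum M g.
Proof.
by move=> NM; apply: (@boxsum_inj_le _ _ id) => // x /leq_trans; apply.
Qed.

Lemma boxsum_shift_le N g x : (forall z, 0 <= g z) ->
  boxsum N (fun y => g (x - y)) <= boxsum (N + supn x) g.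
Proof.
apply: (boxsum_inj_le (f := fun y => x - y)) => [y z /addrI/oppr_inj//|y h].
by rewrite (leq_trans (supnD _ _))// supnN addnC leq_add2r.
Qed.

Lemma boxsum_support N M g : (N <= M)%N -> (forall x, (N < supn x)%N -> g x = 0) ->
  boxsum M g = boxsum N g.
Proof.
move=> NM g0; rewrite !boxsumE (bigID (fun x => supn x <= N)%N) /= [X in _ + X]big1 ?addr0.
  rewrite -big_filter; apply: perm_big; apply: uniq_perm; rewrite ?filter_uniq ?boxseq_uniq//.
  by move=> x; rewrite mem_filter !mem_boxseq; case: leqP => // /leq_trans ->.
by move=> x; rewrite -ltnNge => /g0.
Qed.

Lemma boxsum_ge_term N g a : (supn a <= N)%N -> (forall x, 0 <= g x) -> g a <= boxsum N g.
Proof.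
move=> aN g0; rewrite boxsumE (bigD1_seq a) ?boxseq_uniq ?mem_boxseq//=.
by rewrite lerDl sumr_ge0.
Qed.

Lemma boxsumD N g h : boxsum N (fun x => g x + h x) = boxsum N g + boxsum N h.
Proof. exact: big_split. Qed.

Lemma boxsumB N g h : boxsum N (fun x => g x - h x) = boxsum N g - boxsum N h.
Proof. by rewrite /boxsum -sumrB. Qed.

Lemma boxsumZ N a g : boxsum N (fun x => a * g x) = a * boxsum N g.
Proof. by rewrite /boxsum mulr_sumr. Qed.

Lemma boxsumZr N a g : boxsum N (fun x => g x * a) = boxsum N g * a.
Proof. by rewrite /boxsum mulr_suml. Qed.

Lemma exchange_boxsum N M (F : Zd -> Zd -> R) :
  boxsum N (fun x => boxsum M (F x)) = boxsum M (fun y => boxsum N (fun x => F x y)).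
Proof. exact: exchange_big. Qed.

Lemma boxsum_sum (I : Type) (s : seq I) N (F : I -> Zd -> R) :
  boxsum N (fun x => \sum_(i <- s) F i x) = \sum_(i <- s) boxsum N (F i).
Proof. exact: exchange_big. Qed.

Lemma boxsum_cvg_ge0 g B : (forall x, 0 <= g x) -> (forall N, boxsum N g <= B) ->
  cvgn (fun N => boxsum N g).
Proof.
move=> g0 gB; apply: nondecreasing_is_cvgn.
  by move=> N M NM; apply: boxsum_mono.
by exists B => _ [N _ <-].
Qed.

Lemma boxsum_cvg g B : (forall N, boxsum N (fun x => `|g x|) <= B) ->
  cvgn (fun N => boxsum N g).
Proof.
move=> gB.
have -> : (fun N => boxsum N g) =
    (fun N => boxsum N (fun x => g x + `|g x|) - boxsum N (fun x => `|g x|)).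
  by apply/funext => N; rewrite -boxsumB; apply: eq_boxsum => x; rewrite addrK.
have c1 : cvgn (fun N => boxsum N (fun x => g x + `|g x|)).
  apply: (@boxsum_cvg_ge0 _ (2 * B)) => [x|N].
    by have := ler_norm (- g x); rewrite normrN; lra.
  apply: (@le_trans _ _ (boxsum N (fun x => 2 * `|g x|))).
    by apply: ler_boxsum => x _; have := ler_norm (g x); lra.
  by rewrite boxsumZ ler_pM2l.
have c2 : cvgn (fun N => boxsum N (fun x => `|g x|)).
  by apply: (@boxsum_cvg_ge0 _ B) => // x.
exact: is_cvgB.
Qed.

End LatticeSums.

(** * Exponential series and Cauchy products *)

Section RealSequences.
Variable R : realType.
Implicit Types u a b : nat -> R.

Lemma cvgn_le_bound u l B : u @ \oo --> l -> (forall n, u n <= B) -> l <= B.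
Proof.
move=> ul uB; rewrite -(cvg_lim _ ul)//; apply: limr_le; first exact: cvgP ul.
exact: nearW.
Qed.

Lemma cvgn_sum (T : Type) (s : seq T) (f : T -> nat -> R) (l : T -> R) :
  (forall i, f i @ \oo --> l i) ->
  (fun n => \sum_(i <- s) f i n) @ \oo --> \sum_(i <- s) l i.
Proof.
move=> fl; elim: s => [|i s IH].
  under eq_fun do rewrite big_nil; rewrite big_nil; exact: cvg_cst.
under eq_fun do rewrite big_cons; rewrite big_cons; exact: cvgD.
Qed.

Lemma expR_cvg (x : R) : (fun N => \sum_(k < N) x ^+ k / k`!%:R) @ \oo --> expR x.
Proof.
have := is_cvg_series_exp_coeff x; rewrite /expR /series /=.
by under eq_fun do rewrite big_mkord.
Qed.

Lemma expR_partial (x : R) N : 0 <= x -> \sum_(k < N) x ^+ k / k`!%:R <= expR x.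
Proof.
move=> x0; rewrite -(cvg_lim _ (@expR_cvg x))//.
apply: (nondecreasing_cvgn_le (u_ := fun N => \sum_(k < N) x ^+ k / k`!%:R)); last first.
  exact: cvgP (@expR_cvg x).
apply/nondecreasing_seqP => n; rewrite big_ord_recr /= lerDl.
by rewrite divr_ge0// exprn_ge0.
Qed.

Definition cauchy_prod a b N : R := \sum_(n < N) \sum_(k < n.+1) a k * b (n - k)%N.

Lemma triangle_sum (F : nat -> nat -> R) N :
  \sum_(n < N) \sum_(k < n.+1) F k (n - k)%N = \sum_(i < N) \sum_(j < (N - i)%N) F i j.
Proof.
elim: N => [|N IH]; first by rewrite !big_ord0.
rewrite big_ord_recr /= IH [RHS]big_ord_recr /= subSnn big_ord1.
rewrite [X in _ + X]big_ord_recr /= subnn addrA; congr (_ + _).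
rewrite -big_split /=; apply: eq_bigr => i _.
by rewrite subSn 1?ltnW// big_ord_recr.
Qed.

Lemma cauchy_prod_defect a b N :
  (\sum_(i < N) a i) * (\sum_(j < N) b j) - cauchy_prod a b N =
  \sum_(i < N) \sum_((N - i)%N <= j < N) a i * b j.
Proof.
rewrite /cauchy_prod (triangle_sum (fun i j => a i * b j)) mulr_suml -sumrB.
apply: eq_bigr => i _; rewrite -[X in _ - X]mulr_sumr -mulrBr -mulr_sumr; congr (_ * _).
rewrite -[X in X - _](big_mkord xpredT) -[X in _ - X](big_mkord xpredT).
by rewrite [X in X - _](big_cat_nat (leq0n (N - i)%N) (leq_subr i N)) /= addrAC subrr add0r.
Qed.

Lemma exp_cauchy_prod (A B : R) N :
  cauchy_prod (fun k => A ^+ k / k`!%:R) (fun k => B ^+ k / k`!%:R) N =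
  \sum_(n < N) (A + B) ^+ n / n`!%:R.
Proof.
apply: eq_bigr => n _; rewrite addrC exprDn mulr_suml; apply: eq_bigr => k _.
have kn : (k <= n)%N by rewrite -ltnS.
have f0 m : (m`!%:R : R) != 0 by rewrite pnatr_eq0 -lt0n fact_gt0.
rewrite -(bin_fact kn) !natrM -mulr_natr.
have b0 : ('C(n, k)%:R : R) != 0 by rewrite pnatr_eq0 -lt0n bin_gt0.
by field; rewrite !f0 b0.
Qed.

(* The defect of the Cauchy product is dominated termwise by that of the
   exponential series, which is [expR A * expR B - expR (A + B) = 0] in the limit. *)
Lemma cvg_cauchy_prod a b (A B la lb : R) : 0 <= A -> 0 <= B ->
  (forall k, `|a k| <= A ^+ k / k`!%:R) -> (forall k, `|b k| <= B ^+ k / k`!%:R) ->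
  (fun N => \sum_(k < N) a k) @ \oo --> la ->
  (fun N => \sum_(k < N) b k) @ \oo --> lb ->
  cauchy_prod a b @ \oo --> la * lb.
Proof.
move=> A0 B0 aA bB ala blb.
pose ea (k : nat) : R := A ^+ k / k`!%:R; pose eb (k : nat) : R := B ^+ k / k`!%:R.
pose D a b N : R := (\sum_(i < N) a i) * (\sum_(j < N) b j) - cauchy_prod a b N.
have De : D ea eb @ \oo --> 0.
  have -> : 0 = expR A * expR B - expR (A + B) by rewrite expRD subrr.
  apply: cvgB; first by apply: cvgM; exact: expR_cvg.
  rewrite /ea /eb (funext (exp_cauchy_prod A B)); exact: expR_cvg.
have D0 : D a b @ \oo --> 0.
  apply: norm_cvg0; apply: (@squeeze_cvgr _ _ _ _ (cst 0) (D ea eb)); [|exact: cvg_cst|exact: De].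
  apply: nearW => N; rewrite normr_ge0 /=.
  rewrite /D !cauchy_prod_defect (le_trans (ler_norm_sum _ _ _))//.
  apply: ler_sum => i _; rewrite (le_trans (ler_norm_sum _ _ _))//.
  by apply: ler_sum => j _; rewrite normrM ler_pM.
have : (fun N => (\sum_(i < N) a i) * (\sum_(j < N) b j) - D a b N) @ \oo --> la * lb - 0.
  by apply: cvgB D0; apply: cvgM.
by rewrite subr0; under eq_fun => N do rewrite /D opprB addrC subrK.
Qed.

End RealSequences.

(** * Power series of weighted sums of translations *)

Section Walks.
Variables (R : realType) (d : nat).
Notation Zd := 'rV[int]_d.
Implicit Types (x y z : Zd) (L : seq (R * Zd)).

(* [ewalk L n] is the coefficient of [t ^+ n] in [exp (t * A) 1_0], where [A] is
   the weighted sum of translations [A f x = \sum_(p <- L) p.1 * f (x - p.2)]. *)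
Fixpoint ewalk L n x : R :=
  if n is m.+1 then m.+1%:R^-1 * \sum_(p <- L) p.1 * ewalk L m (x - p.2)
  else ind0 R x.

Definition ewalk_psum L N (t : R) x := \sum_(n < N) t ^+ n * ewalk L n x.

(** Both unit steps in each listed direction. The list is arbitrary so that the walk can be built up
    one coordinate at a time. *)
Definition shifts (I : seq 'I_d) : seq (R * Zd) :=
  flatten [seq [:: (1, unitZ i); (1, - unitZ i)] | i <- I].

Lemma ewalkS L n x :
  n.+1%:R * ewalk L n.+1 x = \sum_(p <- L) p.1 * ewalk L n (x - p.2).
Proof. by rewrite /= mulrA divff ?mul1r// pnatr_eq0. Qed.

Lemma ewalk_ge0 L n x : all (fun p => 0 <= p.1) L -> 0 <= ewalk L n x.
Proof.
move=> L0; elim: n x => [|n IH] x /=; first by rewrite /ind0; case: ifP.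
rewrite mulr_ge0 ?invr_ge0// big_seq sumr_ge0// => p /(allP L0) p0.
by rewrite mulr_ge0.
Qed.

(** Translations commute, so the exponential of a sum is the product of the exponentials; this is
    that identity coefficient by coefficient. In the induction the factor [n.+1] is split as
    [k + (n.+1 - k)]: the first part removes a step [p], the second a step from [L]. *)
Lemma ewalk_cons p L n x : ewalk (p :: L) n x =
  \sum_(k < n.+1) p.1 ^+ k / k`!%:R * ewalk L (n - k) (x - p.2 *+ k).
Proof.
elim: n x => [|n IH] x.
  by rewrite big_ord1 /= mulr0n subr0 expr0 fact0 divr1 mul1r.
have n0 : (n.+1%:R : R) != 0 by rewrite pnatr_eq0.
apply: (mulfI n0); rewrite ewalkS big_cons.
have -> : n.+1%:R * \sum_(k < n.+2) p.1 ^+ k / k`!%:R * ewalk L (n.+1 - k) (x - p.2 *+ k) =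
    \sum_(k < n.+2) k%:R * (p.1 ^+ k / k`!%:R * ewalk L (n.+1 - k) (x - p.2 *+ k)) +
    \sum_(k < n.+2) (n.+1 - k)%:R * (p.1 ^+ k / k`!%:R * ewalk L (n.+1 - k) (x - p.2 *+ k)).
  rewrite -big_split mulr_sumr; apply: eq_bigr => k _ /=.
  by rewrite -mulrDl -natrD subnKC// -ltnS.
congr (_ + _).
  rewrite big_ord_recl mul0r add0r IH mulr_sumr; apply: eq_bigr => k _.
  rewrite lift0 subSS exprS factS natrM (mulrSr p.2) opprD addrA.
  rewrite addrAC; set e := ewalk _ _ _.
  have k0 : (k.+1%:R : R) != 0 by rewrite pnatr_eq0.
  have f0 : (k`!%:R : R) != 0 by rewrite pnatr_eq0 -lt0n fact_gt0.
  by field; rewrite f0 nat1r k0.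
rewrite [RHS]big_ord_recr /= subnn mul0r addr0.
under eq_bigr do rewrite IH mulr_sumr.
rewrite exchange_big; apply: eq_bigr => k _ /=.
have kn : (k <= n)%N by rewrite -ltnS.
rewrite subSn// mulrCA ewalkS mulr_sumr; apply: eq_bigr => q _.
by rewrite mulrCA; congr (_ * (_ * ewalk _ _ _)); rewrite -!addrA [- _ + _]addrC.
Qed.

Lemma sum_shifts I (F : R * Zd -> R) : \sum_(p <- shifts I) F p =
  \sum_(i <- I) (F (1, unitZ i) + F (1, - unitZ i)).
Proof.
rewrite big_flatten big_map; apply: eq_bigr => i _.
by rewrite !big_cons big_nil /= addr0.
Qed.

Lemma shifts_ge0 I : all (fun p => 0 <= p.1) (shifts I).
Proof. by elim: I => //= i I ->; rewrite !ler01. Qed.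

(** The operator -Delta is the sum of the [2 d] unit translations plus a step of displacement 0 and
    weight [- 2 d]. By [ewalk_cons] this extra step later becomes the scalar factor
    [expR (- (2 * d%:R * t))]. *)
Lemma lapn_ewalk n x : (-1) ^+ n / n`!%:R * lapn n (@ind0 R d) x =
  ewalk ((- (2 * d%:R), 0) :: shifts (enum 'I_d)) n x.
Proof.
elim: n x => [|n IH] x; first by rewrite expr0 fact0 divr1 mul1r.
have n0 : (n.+1%:R : R) != 0 by rewrite pnatr_eq0.
have f0 : (n`!%:R : R) != 0 by rewrite pnatr_eq0 -lt0n fact_gt0.
have lapS : lapn n.+1 (@ind0 R d) x = lap (lapn n (@ind0 R d)) x by [].
apply: (mulfI n0); rewrite ewalkS big_cons sum_shifts lapS {lapS}.
move: (lapn n _) IH => f IH; rewrite subr0 -IH big_enum /=.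
under [in RHS]eq_bigr => i _ do rewrite !mul1r -!IH opprK.
rewrite /lap exprS factS natrM mulN1r.
set c := (-1) ^+ n / n`!%:R.
have -> : - (-1) ^+ n / (n.+1%:R * n`!%:R) = - c / n.+1%:R.
  by rewrite /c; field; rewrite f0 nat1r n0.
rewrite mulrA mulrCA divff// mulr1.
rewrite (eq_bigr (fun i => 2 * f x - (f (x - unitZ i) + f (x + unitZ i)))); last first.
  by move=> i _; ring.
rewrite sumrB sumr_const card_ord -mulr_natr.
rewrite [in RHS](eq_bigr (fun i => c * (f (x - unitZ i) + f (x + unitZ i)))); last first.
  by move=> i _; rewrite mulrDr.
by rewrite -mulr_sumr; ring.
Qed.

End Walks.

(** * Positivity, mass and second moment of the heat kernel *)

Section HeatKernel.
Variables (R : realType) (d : nat).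
Notation Zd := 'rV[int]_d.
Implicit Types (x y z : Zd) (L : seq (R * Zd)).

Definition normsq x : R := \sum_(i < d) (x 0 i)%:~R ^+ 2.

Let sh : seq (R * Zd) := shifts R (enum 'I_d).

Lemma normsq_ge0 x : 0 <= normsq x.
Proof. by apply: sumr_ge0 => i _; rewrite sqr_ge0. Qed.

Lemma normsq_shift y i :
  normsq (y + unitZ i) + normsq (y - unitZ i) = 2 * normsq y + 2.
Proof.
rewrite /normsq -big_split mulr_sumr /= (bigD1 i)//= [in RHS](bigD1 i)//=.
rewrite !mxE !eqxx /= !intrD ?mulrNz.
rewrite [X in _ + X](eq_bigr (fun j => 2 * (y 0 j)%:~R ^+ 2)) => [|j ji].
  by ring.
by rewrite !mxE (negbTE ji) !eqxx /= !intrD ?mulrNz; ring.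
Qed.

Lemma supn_unitZ (i : 'I_d) : (supn (unitZ i) <= 1)%N.
Proof. by apply/supn_leqP => j; rewrite mxE; case: (_ && _). Qed.

(** Peeling off one step shifts the test function instead of the walk; the box grows by 1 because no
    step is longer than 1. *)
Lemma boxsum_ewalkS L N n (g : Zd -> R) : all (fun p => 0 <= p.1) L ->
  all (fun p => supn p.2 <= 1)%N L -> (forall x, 0 <= g x) ->
  n.+1%:R * boxsum N (fun x => ewalk L n.+1 x * g x) <=
  \sum_(p <- L) p.1 * boxsum N.+1 (fun y => ewalk L n y * g (y + p.2)).
Proof.
move=> L0 L1 g0; rewrite -boxsumZ.
under eq_boxsum do rewrite mulrA ewalkS mulr_suml.
rewrite boxsum_sum big_seq [leRHS]big_seq; apply: ler_sum => p pL.
under eq_boxsum do rewrite -mulrA.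
rewrite boxsumZ ler_wpM2l ?(allP L0 p pL)//.
under eq_boxsum => x do rewrite -[in g x](subrK p.2 x).
apply: (boxsum_inj_le (f := fun x => x - p.2)
  (g := fun y => ewalk L n y * g (y + p.2))) => [a b /addIr//|x xN|x].
  by rewrite (leq_trans (supnD _ _))// supnN -[N.+1]addn1 leq_add// (allP L1 p pL).
by rewrite mulr_ge0// ewalk_ge0.
Qed.

Lemma shifts_le1 I : all (fun p => supn p.2 <= 1)%N (shifts R (d := d) I).
Proof. by elim: I => //= i I ->; rewrite supnN supn_unitZ. Qed.

Lemma boxsum_ewalk_le N n : boxsum N (ewalk sh n) <= (2 * d%:R) ^+ n / n`!%:R.
Proof.
elim: n N => [|n IH] N.
  rewrite expr0 fact0 divr1 (@boxsum_support _ _ 0 N)//; last first.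
    by move=> x; rewrite lt0n supn_eq0 /= /ind0 => /negbTE ->.
  rewrite boxsumE; have -> : boxseq d 0 = [:: 0]; last by rewrite big_seq1 /= /ind0 eqxx.
  apply/perm_small_eq => //; apply: uniq_perm; rewrite ?boxseq_uniq// => x.
  by rewrite mem_boxseq leqn0 supn_eq0 inE.
have n0 : (0 : R) < n.+1%:R by rewrite ltr0n.
rewrite -(ler_pM2l n0).
under eq_boxsum do rewrite -[ewalk _ _ _]mulr1.
rewrite (le_trans (boxsum_ewalkS _ _ (g := fun=> 1) _ _ _)) ?shifts_ge0 ?shifts_le1//.
rewrite sum_shifts /=.
under eq_bigr do rewrite !mul1r.
under eq_boxsum do rewrite mulr1.
rewrite big_enum sumr_const card_ord -[_ *+ d]mulr_natr.
rewrite exprS factS natrM.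
have f0 : (n`!%:R : R) != 0 by rewrite pnatr_eq0 -lt0n fact_gt0.
have -> : n.+1%:R * (2 * d%:R * (2 * d%:R) ^+ n / (n.+1%:R * n`!%:R)) =
   (2 * d%:R) * ((2 * d%:R) ^+ n / n`!%:R) :> R by field; rewrite f0 nat1r pnatr_eq0.
rewrite -mulr2n -[boxsum _ _ *+ 2]mulr_natl mulrAC ler_wpM2l//.
Qed.

(** The mean squared displacement after [n] unit steps is [n]: averaged over a step and its
    opposite, [normsq] increases by exactly 1. The other factor is the total mass of the [n]-step
    coefficient. *)
Lemma boxsum_ewalk_normsq_le N n :
  boxsum N (fun x => ewalk sh n x * normsq x) <= n%:R * ((2 * d%:R) ^+ n / n`!%:R).
Proof.
elim: n N => [|n IH] N.
  rewrite mul0r /boxsum big1// => k _; rewrite /= /ind0; case: eqP => [->|]; last by rewrite mul0r.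
  by rewrite /normsq big1 ?mulr0// => i _; rewrite mxE expr0n.
have n0 : (0 : R) < n.+1%:R by rewrite ltr0n.
rewrite -(ler_pM2l n0).
rewrite (le_trans (boxsum_ewalkS _ _ (g := normsq) _ _ _)) ?shifts_ge0 ?shifts_le1//.
  exact: normsq_ge0.
rewrite sum_shifts /=.
under eq_bigr => i _.
  rewrite !mul1r -boxsumD.
  under eq_boxsum do rewrite -mulrDr normsq_shift mulrDr mulrCA.
  rewrite boxsumD boxsumZ boxsumZr.
  over.
rewrite big_enum sumr_const card_ord -[_ *+ d]mulr_natl.
have f0 : (n`!%:R : R) != 0 by rewrite pnatr_eq0 -lt0n fact_gt0.
have -> : n.+1%:R * (n.+1%:R * ((2 * d%:R) ^+ n.+1 / n.+1`!%:R)) =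
  d%:R * (2 * (n%:R * ((2 * d%:R) ^+ n / n`!%:R)) + ((2 * d%:R) ^+ n / n`!%:R) * 2) :> R.
  by rewrite exprS factS natrM; field; rewrite f0 nat1r pnatr_eq0.
by rewrite ler_wpM2l// lerD// ?ler_pM2l// ler_pM2r// boxsum_ewalk_le.
Qed.

Lemma ewalk_sh_le n x : ewalk sh n x <= (2 * d%:R) ^+ n / n`!%:R.
Proof.
apply: le_trans (boxsum_ewalk_le (supn x) n).
by apply: boxsum_ge_term => // y; rewrite ewalk_ge0// shifts_ge0.
Qed.

Lemma ewalk_psum_cvg t x : 0 <= t -> cvgn (fun N => ewalk_psum sh N t x).
Proof.
move=> t0; apply: nondecreasing_is_cvgn.
  apply/nondecreasing_seqP => n; rewrite /ewalk_psum big_ord_recr lerDl.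
  by rewrite mulr_ge0 ?exprn_ge0// ewalk_ge0// shifts_ge0.
exists (expR (2 * d%:R * t)) => _ [N _ <-].
apply: le_trans (expR_partial N _); last by rewrite !mulr_ge0.
apply: ler_sum => n _; rewrite exprMn mulrAC [leRHS]mulrC.
by rewrite ler_wpM2l ?exprn_ge0// ewalk_sh_le.
Qed.

Lemma heat_partial_cvg (t : R) x : 0 <= t ->
  (fun M => \sum_(n < M) ((- t) ^+ n / n`!%:R * lapn n (@ind0 R d) x)) @ \oo -->
  expR (- (2 * d%:R * t)) * limn (fun N => ewalk_psum sh N t x).
Proof.
move=> t0; pose a k : R := (- (2 * d%:R * t)) ^+ k / k`!%:R.
pose b k : R := t ^+ k * ewalk sh k x.
have dt0 : 0 <= 2 * d%:R * t by rewrite !mulr_ge0.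
have -> : (fun M => \sum_(n < M) ((- t) ^+ n / n`!%:R * lapn n (@ind0 R d) x)) =
    cauchy_prod a b.
  apply/funext => M; apply: eq_bigr => n _.
  have -> : (- t) ^+ n / n`!%:R * lapn n (@ind0 R d) x =
      t ^+ n * ((-1) ^+ n / n`!%:R * lapn n (@ind0 R d) x).
    by rewrite [(- t) ^+ n]exprNn; ring.
  rewrite lapn_ewalk ewalk_cons mulr_sumr; apply: eq_bigr => k _.
  rewrite mul0rn subr0 /a /b /=.
  have -> : t ^+ n = t ^+ (n - k) * t ^+ k by rewrite -exprD subnK// -ltnS.
  rewrite -[- (2 * d%:R * t)]mulNr exprMn.
  by move: (t ^+ (n - k)) (t ^+ k) (ewalk _ _ _) (_ ^+ k) => A B C D; ring.
apply: (cvg_cauchy_prod dt0 dt0).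
- by move=> k; rewrite /a normrM normrX normrN !ger0_norm ?invr_ge0.
- move=> k; rewrite /b normrM ger0_norm ?exprn_ge0//.
  rewrite ger0_norm ?ewalk_ge0 ?shifts_ge0// exprMn mulrAC [leRHS]mulrC.
  by rewrite ler_wpM2l ?exprn_ge0// ewalk_sh_le.
- exact: expR_cvg.
- exact: ewalk_psum_cvg.
Qed.

Lemma heatE (t : R) x : 0 <= t ->
  heat t x = expR (- (2 * d%:R * t)) * limn (fun N => ewalk_psum sh N t x).
Proof. by move=> t0; apply/cvg_lim => //; exact: heat_partial_cvg. Qed.

Lemma heat_ge_psum (t : R) x N : 0 <= t ->
  expR (- (2 * d%:R * t)) * ewalk_psum sh N t x <= heat t x.
Proof.
move=> t0; rewrite heatE// ler_wpM2l ?expR_ge0//.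
apply: (nondecreasing_cvgn_le (u_ := fun N => ewalk_psum sh N t x)); last exact: ewalk_psum_cvg.
apply/nondecreasing_seqP => n; rewrite /ewalk_psum big_ord_recr lerDl.
by rewrite mulr_ge0 ?exprn_ge0// ewalk_ge0// shifts_ge0.
Qed.

Lemma heat_ge0 (t : R) x : 0 <= t -> 0 <= heat t x.
Proof.
by move=> t0; apply: le_trans (heat_ge_psum x 0 t0); rewrite /ewalk_psum big_ord0 mulr0.
Qed.

(** Mass at most 1 and second moment at most [2 d t] in one statement. Every upper bound on the
    kernel comes from majorising a weight by an affine function of [normsq]. *)
Lemma boxsum_heat_le N (t : R) (w : Zd -> R) (al be : R) : 0 <= t -> 0 <= al -> 0 <= be ->
  (forall z, 0 <= w z <= al + be * normsq z) ->
  boxsum N (fun z => heat t z * w z) <= al + be * (2 * d%:R * t).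
Proof.
move=> t0 al0 be0 wab; set T := 2 * d%:R * t.
have T0 : 0 <= T by rewrite !mulr_ge0.
under eq_boxsum do rewrite heatE// -mulrA.
rewrite boxsumZ expRN mulrC ler_pdivrMr ?expR_gt0//.
have -> : 2 * d%:R * t = T by [].
apply: (@cvgn_le_bound _ (fun M => boxsum N (fun z => ewalk_psum sh M t z * w z))).
  apply: cvgn_sum => k; apply: cvgM; [exact: ewalk_psum_cvg|exact: cvg_cst].
move=> M.
apply: (@le_trans _ _ (\sum_(n < M) t ^+ n * (al * ((2 * d%:R) ^+ n / n`!%:R) +
   be * (n%:R * ((2 * d%:R) ^+ n / n`!%:R))))).
  under eq_boxsum do rewrite mulr_suml.
  rewrite boxsum_sum; apply: ler_sum => n _.
  under eq_boxsum do rewrite -mulrA.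
  rewrite boxsumZ ler_wpM2l ?exprn_ge0//.
  apply: (@le_trans _ _ (boxsum N (fun z => al * ewalk sh n z + be * (ewalk sh n z * normsq z)))).
    apply: ler_boxsum => z _; have /andP[_ wz] := wab z.
    have -> : al * ewalk sh n z + be * (ewalk sh n z * normsq z) =
      ewalk sh n z * (al + be * normsq z) by ring.
    rewrite ler_wpM2l//.
    by rewrite ewalk_ge0// shifts_ge0.
  rewrite boxsumD !boxsumZ lerD// ler_wpM2l//.
  - exact: boxsum_ewalk_le.
  - exact: boxsum_ewalk_normsq_le.
have E : forall K, \sum_(n < K) T ^+ n / n`!%:R <= expR T by move=> K; apply: expR_partial.
rewrite (eq_bigr (fun n : 'I_M => al * (T ^+ n / n`!%:R) + be * (n%:R * (T ^+ n / n`!%:R))));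
  last by move=> n _; rewrite /T !exprMn; ring.
rewrite big_split /= -!mulr_sumr mulrDl -mulrA lerD// ler_wpM2l//.
  exact: E.
case: M => [|M]; first by rewrite big_ord0 mulr_ge0 ?expR_ge0.
rewrite big_ord_recl mul0r add0r.
rewrite (eq_bigr (fun n : 'I_M => T * (T ^+ n / n`!%:R))); last first.
  move=> n _; rewrite lift0 exprS factS natrM.
  have f0 : (n`!%:R : R) != 0 by rewrite pnatr_eq0 -lt0n fact_gt0.
  by field; rewrite f0 nat1r pnatr_eq0.
by rewrite -mulr_sumr ler_wpM2l// E.
Qed.

End HeatKernel.

(** * A one-sided Stirling bound and Poisson weights near the mean *)

Section FactorialBounds.
Variable R : realType.

(** For [q < 1], [(1 + q) / (1 - q)] expands as [1 + 2 q + 2 q ^ 2 + ...], and the coefficients of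
    [expR (2 * q)] satisfy [2 ^ k / k! <= 2]. The product form also covers [q = 1]. *)
Lemma expR_le_homography (q : R) : 0 <= q <= 1 -> (1 - q) * expR (2 * q) <= 1 + q.
Proof.
move=> /andP[q0 q1].
have fk k : (2 ^+ k / k`!%:R : R) <= 2.
  rewrite ler_pdivrMr ?ltr0n ?fact_gt0// -natrX -natrM ler_nat.
  elim: k => // -[|k] IH; first by [].
  by rewrite expnS factS; lia.
have S N : (1 - q) * \sum_(k < N.+1) (2 * q) ^+ k / k`!%:R <= 1 + q - 2 * q ^+ N.+1.
  elim: N => [|N IH]; first by rewrite big_ord1 expr0 fact0 expr1; lra.
  rewrite big_ord_recr /= mulrDr.
  have : (1 - q) * ((2 * q) ^+ N.+1 / (N.+1)`!%:R) <= (1 - q) * (2 * q ^+ N.+1).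
    rewrite ler_wpM2l ?subr_ge0// exprMn mulrAC ler_wpM2r ?exprn_ge0//.
  move: IH; rewrite [q ^+ N.+2]exprS; lra.
apply: (@cvgn_le_bound _ (fun N => (1 - q) * \sum_(k < N) (2 * q) ^+ k / k`!%:R)).
  by apply: cvgM; [exact: cvg_cst|exact: expR_cvg].
case=> [|N]; first by rewrite big_ord0 mulr0; lra.
by apply: le_trans (S N) _; rewrite gerBl mulr_ge0// exprn_ge0.
Qed.

(** The choice [q = 1 / (2 m + 1)] makes [(1 + q) / (1 - q)] equal to [1 + 1 / m]; then the power
    [2 m + 1] is taken. *)
Lemma expR2_le (m : nat) : (0 < m)%N -> expR 2 <= (1 + m%:R^-1) ^+ m.*2.+1 :> R.
Proof.
move=> m0; have mp : (0 : R) < m%:R by rewrite ltr0n.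
pose q : R := (2 * m%:R + 1)^-1.
have q01 : 0 <= q <= 1.
  by rewrite /q invr_ge0 invf_le1; [apply/andP; split; lra|lra].
have -> : 2 = (2 * q) * m.*2.+1%:R :> R.
  by rewrite -[m.*2.+1%:R]natr1 -mul2n natrM /q; field; lra.
rewrite expRM_natr lerXn2r ?nnegrE ?expR_ge0 ?addr_ge0 ?invr_ge0//.
have q1 : 0 < 1 - q.
  by rewrite subr_gt0 /q invf_lt1; lra.
rewrite -(ler_pM2l q1) (le_trans (expR_le_homography q01))//.
by rewrite le_eqVlt; apply/orP; left; apply/eqP; rewrite /q; field; lra.
Qed.

(** The induction step asks for [e * sqrt m * m ^ m <= sqrt (m + 1) * (m + 1) ^ m], and the square
    of this is [expR2_le]. *)
Lemma fact_le_stirling (m : nat) : (0 < m)%N ->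
  m`!%:R * expR m%:R <= expR 1 * Num.sqrt m%:R * m%:R ^+ m :> R.
Proof.
elim: m => // -[|m] IH _; first by rewrite factS fact0 muln1 sqrtr1 expr1n !mulr1 mul1r.
have {}IH := IH isT; set M := m.+1 in IH *.
have Mp : (0 : R) < M%:R by rewrite ltr0n.
have M1p : (0 : R) < M.+1%:R by rewrite ltr0n.
have key : expR 1 * Num.sqrt M%:R * M%:R ^+ M <= Num.sqrt M.+1%:R * M.+1%:R ^+ M :> R.
  rewrite -(@ler_sqr R) ?nnegrE ?mulr_ge0 ?expR_ge0 ?sqrtr_ge0 ?exprn_ge0//.
  rewrite !exprMn !sqr_sqrtr ?ler0n// -expRM_natr mul1r -!exprM muln2.
  rewrite -mulrA -!exprS.
  have -> : M.+1%:R = M%:R * (1 + M%:R^-1) :> R.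
    by rewrite mulrDr mulr1 divff ?gt_eqF// natr1.
  by rewrite exprMn mulrC ler_wpM2l ?exprn_ge0 ?expR2_le.
rewrite factS natrM -[in expR (M.+1)%:R]natr1 expRD exprS.
have -> : M.+1%:R * M`!%:R * (expR M%:R * expR 1) =
  (M.+1%:R * expR 1) * (M`!%:R * expR M%:R) :> R by ring.
apply: le_trans (ler_wpM2l _ IH) _; first by rewrite mulr_ge0 ?expR_ge0.
have -> : expR 1 * Num.sqrt M.+1%:R * (M.+1%:R * M.+1%:R ^+ M) =
  (M.+1%:R * expR 1) * (Num.sqrt M.+1%:R * M.+1%:R ^+ M) :> R by ring.
by rewrite ler_wpM2l// mulr_ge0 ?expR_ge0.
Qed.

(** The window lies within two standard deviations above the mean [t = s ^ 2]. With [h = m - t], the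
    inequality [1 + h / t <= expR (h / t)] and [h ^ 2 / t <= 4] give
    [m ^ m <= t ^ m * expR (h + 4)]. Stirling contributes one more factor [e], hence [expR (- 5)],
    and [sqrt m <= 2 * s]. *)
Lemma poisson_weight_ge (s : R) (m : nat) : 2 <= s -> s ^+ 2 <= m%:R <= s ^+ 2 + 2 * s ->
  expR (s ^+ 2) * (expR (- 5) / (2 * s)) <= (s ^+ 2) ^+ m / m`!%:R.
Proof.
move=> s2 /andP[tm mt]; set t := s ^+ 2 in tm mt *.
have t4 : 4 <= t by rewrite /t expr2; nra.
have ts : 2 * s <= t by rewrite /t expr2; nra.
have tp : 0 < t by lra.
have m0 : (0 < m)%N by rewrite -(@ltr0n R); lra.
have fp : (0 : R) < m`!%:R by rewrite ltr0n fact_gt0.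
have sq : Num.sqrt m%:R <= 2 * s.
  rewrite -[2 * s]ger0_norm -?sqrtr_sqr; last by lra.
  by apply: ler_wsqrtr; rewrite exprMn -/t; lra.
set h := m%:R - t.
have h0 : 0 <= h by rewrite /h; lra.
have hs : h <= 2 * s by rewrite /h; lra.
have mm : m%:R ^+ m <= t ^+ m * expR (h + 4).
  have -> : m%:R = t * (1 + h / t) :> R by rewrite /h; field; lra.
  rewrite exprMn (ler_wpM2l (exprn_ge0 m (ltW tp)))//.
  apply: (@le_trans _ _ (expR (h / t) ^+ m)).
    by rewrite lerXn2r ?nnegrE ?expR_ge0 ?expR_ge1Dx// addr_ge0// divr_ge0 ?(ltW tp).
  rewrite -expRM_natr ler_expR.
  have -> : h / t * m%:R = h + h ^+ 2 / t by rewrite /h; field; lra.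
  rewrite lerD2l ler_pdivrMr// /t; rewrite !expr2; nra.
have St := fact_le_stirling m0.
have {}St : m`!%:R * expR m%:R <= expR 1 * (2 * s) * (t ^+ m * expR (h + 4)).
  apply: le_trans St _; rewrite ler_pM ?mulr_ge0 ?expR_ge0 ?sqrtr_ge0 ?exprn_ge0//.
  by rewrite ler_wpM2l ?expR_ge0.
rewrite ler_pdivlMr// mulrA mulrAC ler_pdivrMr; last by lra.
rewrite -(ler_pM2r (expR_gt0 m%:R)) -mulrA.
apply: le_trans (ler_wpM2l _ St) _; first by rewrite mulr_ge0 ?expR_ge0.
rewrite le_eqVlt; apply/orP; left; apply/eqP.
have -> : expR m%:R = expR t * expR (-5) * expR 1 * expR (h + 4).
  by rewrite -!expRD; congr expR; rewrite /h; ring.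
by ring.
Qed.

End FactorialBounds.

(** * Heat kernel lower bound at distance at most the square root of time *)

Section HeatLowerBound.
Variables (R : realType) (d : nat).
Notation Zd := 'rV[int]_d.
Implicit Types (x y z e : Zd) (L : seq (R * Zd)).

Lemma ewalk_psum_ge0 L N t x : all (fun p => 0 <= p.1) L -> 0 <= t -> 0 <= ewalk_psum L N t x.
Proof. by move=> L0 t0; apply: sumr_ge0 => n _; rewrite mulr_ge0 ?exprn_ge0 ?ewalk_ge0. Qed.

Lemma ler_sum_ord (F : nat -> R) m n : (m <= n)%N -> (forall i, 0 <= F i) ->
  \sum_(i < m) F i <= \sum_(i < n) F i.
Proof.
move=> mn F0; rewrite -!(big_mkord xpredT F) [leRHS](big_cat_nat (leq0n m) mn) /=.
by rewrite lerDl sumr_ge0.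
Qed.

(** For truncated series the product formula survives as an inequality: the rectangle [k < K],
    [j < N] lies inside the triangle [k + j < K + N], and the discarded terms are nonnegative. *)
Lemma ewalk_psum_cons L e K N t x : all (fun p => 0 <= p.1) L -> 0 <= t ->
  \sum_(k < K) t ^+ k / k`!%:R * ewalk_psum L N t (x - e *+ k) <=
  ewalk_psum ((1, e) :: L) (K + N) t x.
Proof.
move=> L0 t0.
pose F k j : R := t ^+ k / k`!%:R * (t ^+ j * ewalk L j (x - e *+ k)).
have F0 i j : 0 <= F i j by rewrite /F !mulr_ge0 ?invr_ge0 ?exprn_ge0 ?ewalk_ge0.
have -> : ewalk_psum ((1, e) :: L) (K + N) t x =
    \sum_(n < (K + N)%N) \sum_(k < n.+1) F k (n - k)%N.
  apply: eq_bigr => n _; rewrite ewalk_cons mulr_sumr; apply: eq_bigr => k _.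
  have -> : t ^+ n = t ^+ (n - k) * t ^+ k by rewrite -exprD subnK// -ltnS.
  rewrite /F /= expr1n.
  by move: (t ^+ (n - k)) (t ^+ k) (ewalk _ _ _) => A B C; ring.
rewrite triangle_sum.
apply: (@le_trans _ _ (\sum_(k < K) \sum_(j < (K + N - k)%N) F k j)).
  apply: ler_sum => k _; rewrite mulr_sumr; apply: (ler_sum_ord (F := F k)) => //.
  by rewrite addnC -addnBA ?leq_addr// ltnW.
by apply: (ler_sum_ord (F := fun k => \sum_(j < (K + N - k)%N) F k j));
  rewrite ?leq_addr// => i; apply: sumr_ge0.
Qed.

(** Keeps only the paths with [l + j] steps [e] and [l] steps [- e], whose net displacement in that
    direction is [j] steps. *)
Lemma ewalk_psum_pair L e (K N j : nat) t x : all (fun p => 0 <= p.1) L -> 0 <= t ->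
  \sum_(l < K) t ^+ (l + j) / (l + j)`!%:R * (t ^+ l / l`!%:R) * ewalk_psum L N t (x - e *+ j) <=
  ewalk_psum [:: (1, e), (1, - e) & L] (K + j + (K + N)) t x.
Proof.
move=> L0 t0; have L0' : all (fun p => 0 <= p.1) ((1, - e) :: L) by rewrite /= ler01.
have F0 k y : 0 <= t ^+ k / k`!%:R * ewalk_psum L N t y.
  by rewrite !mulr_ge0 ?invr_ge0 ?exprn_ge0 ?ewalk_psum_ge0.
apply: le_trans (ewalk_psum_cons e (K + j) (K + N) x L0' t0).
pose G k := t ^+ k / k`!%:R * ewalk_psum ((1, - e) :: L) (K + N) t (x - e *+ k).
have G0 k : 0 <= G k by rewrite /G !mulr_ge0 ?invr_ge0 ?exprn_ge0 ?ewalk_psum_ge0.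
apply: (@le_trans _ _ (\sum_(l < K) G (l + j)%N)).
  apply: ler_sum => l _; rewrite -mulrA ler_wpM2l ?divr_ge0 ?exprn_ge0//.
  apply: le_trans (ewalk_psum_cons (- e) K N _ L0 t0).
  rewrite (bigD1 l)//= -[leLHS]addr0 lerD ?sumr_ge0//.
  by rewrite mulrnDr mulNrn opprK opprD addrA addrAC subrK.
have -> : \sum_(l < K) G (l + j)%N = \sum_(j <= l < K + j) G l.
  by rewrite -(big_mkord xpredT (fun l => G (l + j)%N)) -[j in RHS]add0n big_addn addnK.
rewrite -(big_mkord xpredT G) (big_cat_nat (leq0n j) (leq_addl K j)) /= lerDr.
exact: sumr_ge0.
Qed.

Lemma ewalk_psum_pairN L e N t x :
  ewalk_psum [:: (1, - e), (1, e) & L] N t x = ewalk_psum [:: (1, e), (1, - e) & L] N t x.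
Proof.
apply: eq_bigr => n _; congr (_ * _); elim: (nat_of_ord n) x => // {}n IH x /=.
rewrite !big_cons /= !mul1r !IH addrCA; congr (_ * (_ + (_ + _))).
by apply: eq_bigr => p _; rewrite IH.
Qed.

(** For at least [s / 2] consecutive values of [l] just above [s ^ 2], both [l] and [l + j] fall in
    the window of [poisson_weight_ge]. Each product is then at least the square of that bound, and
    [s / 2] of them turn [4 * s ^ 2] into [8 * s] in the denominator. *)
Lemma poisson_pair_sum_ge (s : R) : 2 <= s -> exists K : nat, forall j : nat, j%:R <= s ->
  expR (2 * s ^+ 2) * (expR (- 10) / (8 * s)) <=
  \sum_(l < K) (s ^+ 2) ^+ (l + j) / (l + j)`!%:R * ((s ^+ 2) ^+ l / l`!%:R).
Proof.
move=> s2; set t := s ^+ 2.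
have t0 : 0 <= t by rewrite sqr_ge0.
have s0 : 0 <= s by lra.
pose a := (Num.truncn t).+1; pose Q := Num.truncn s.
have /andP[ta at1] := truncn_itv t0; have /andP[Qs sQ] := truncn_itv s0.
exists (a + Q)%N => j js.
pose G l : R := t ^+ (l + j) / (l + j)`!%:R * (t ^+ l / l`!%:R).
have G0 l : 0 <= G l by rewrite /G !mulr_ge0 ?invr_ge0 ?exprn_ge0.
rewrite -(big_mkord xpredT G) (big_cat_nat (leq0n a) (leq_addr Q a)) /=.
apply: (@le_trans _ _ (\sum_(a <= l < a + Q) G l)); last by rewrite lerDr sumr_ge0.
pose c := expR t * (expR (- 5) / (2 * s)).
have cl l : (a <= l < a + Q)%N -> c * c <= G l.
  move=> /andP[al lQ].
  have al' : a%:R <= l%:R :> R by rewrite ler_nat.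
  have lQ' : l.+1%:R <= (a + Q)%:R :> R by rewrite ler_nat.
  move: lQ' al'; rewrite natrD /a -!natr1 => lQ' al'.
  rewrite -natr1 in at1.
  have j0 : 0 <= j%:R :> R by [].
  rewrite ler_pM ?mulr_ge0 ?invr_ge0 ?expR_ge0//; try lra.
    by apply: poisson_weight_ge => //; rewrite natrD -/t; apply/andP; split; rewrite /Q in lQ' *; lra.
  by apply: poisson_weight_ge => //; rewrite -/t; apply/andP; split; rewrite /Q in lQ' *; lra.
apply: (@le_trans _ _ (\sum_(a <= l < a + Q) c * c)); last first.
  by rewrite big_nat_cond [leRHS]big_nat_cond; apply: ler_sum => l /andP[/cl].
rewrite sumr_const_nat addKn -[_ *+ Q]mulr_natr.
have -> : expR (2 * t) * (expR (-10) / (8 * s)) = c * c * (s / 2).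
  have -> : 2 * t = t + t by ring.
  have -> : -10 = -5 + -5 :> R by ring.
  by rewrite !expRD /c; field; lra.
rewrite ler_wpM2l ?mulr_ge0 ?invr_ge0 ?expR_ge0//; try lra.
Qed.

Lemma ewalk_psum_lower (s : R) (I : seq 'I_d) x : 2 <= s -> uniq I ->
  (forall i, i \notin I -> x 0 i = 0) -> (supn x)%:R <= s ->
  exists N, (expR (2 * s ^+ 2) * (expR (- 10) / (8 * s))) ^+ size I <=
    ewalk_psum (shifts R I) N (s ^+ 2) x.
Proof.
move=> s2; elim: I x => [|i I IH] x /=.
  move=> _ x0 _; exists 1%N; rewrite /ewalk_psum big_ord1 /= mul1r /ind0.
  have -> : x = 0 by apply/rowP => i; rewrite mxE x0.
  by rewrite eqxx.
move=> /andP[iI uI] x0 xs.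
(* Coordinate [i] is cleared: its displacement is produced by the pair of steps along [unitZ i], the
   remaining point by the steps in [I]. *)
pose x' := x - x 0 i *: unitZ i.
have x'E k : x' 0 k = if k == i then 0 else x 0 k.
  by rewrite !mxE eqxx /=; case: eqP => [->|_]; rewrite ?mulr1 ?subrr// mulr0 subr0.
have sx' : (supn x' <= supn x)%N.
  by apply/supn_leqP => k; rewrite x'E; case: ifP => // _; exact: leq_supn.
have [||N HN] := IH x' uI.
- by move=> k kI; rewrite x'E; case: eqP => // /eqP ki; rewrite x0// inE negb_or ki.
- by rewrite (le_trans _ xs)// ler_nat.
have [K HK] := poisson_pair_sum_ge s2.
pose j := `|x 0%R i|%N.
have js : j%:R <= s by rewrite (le_trans _ xs)// ler_nat leq_supn.
have t0 : 0 <= s ^+ 2 by rewrite sqr_ge0.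
exists (K + j + (K + N))%N; rewrite exprS.
have B e : x - e *+ j = x' -> expR (2 * s ^+ 2) * (expR (-10) / (8 * s)) *
    (expR (2 * s ^+ 2) * (expR (-10) / (8 * s))) ^+ size I <=
    ewalk_psum [:: (1, e), (1, - e) & shifts R I] (K + j + (K + N)) (s ^+ 2) x.
  move=> ex; apply: le_trans (ewalk_psum_pair e K N j x (shifts_ge0 _ I) t0).
  rewrite ex -mulr_suml ler_pM ?HK// ?exprn_ge0// mulr_ge0 ?divr_ge0 ?expR_ge0//; lra.
rewrite -/(shifts R I).
have [xi|xi] := leP 0 (x 0 i).
  by apply: B; rewrite /x' /j -scaler_nat natz gez0_abs.
rewrite -ewalk_psum_pairN -{2}[unitZ i]opprK; apply: B.
by rewrite /x' /j -scaler_nat natz ltz0_abs// scalerN scaleNr opprK.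
Qed.

(** At time [s ^ 2] the [d] factors [expR (2 * s ^ 2)], one per coordinate, cancel the prefactor
    [expR (- (2 * d%:R * t))]. *)
Lemma heat_lower (s : R) x : 2 <= s -> (supn x)%:R <= s ->
  (expR (- 10) / (8 * s)) ^+ d <= heat (s ^+ 2) x.
Proof.
move=> s2 xs; have t0 : 0 <= s ^+ 2 by rewrite sqr_ge0.
have [|N HN] := ewalk_psum_lower (x := x) s2 (enum_uniq 'I_d) _ xs.
  by move=> i; rewrite mem_enum.
apply: le_trans (heat_ge_psum x N t0).
apply: le_trans (ler_wpM2l (expR_ge0 _) HN).
rewrite size_enum_ord [(expR (2 * s ^+ 2) * _) ^+ d]exprMn mulrA -(expRM_natl d (2 * _)) -(expRD (- _)).
by rewrite (_ : - _ + _ = 0) ?expR0 ?mul1r//; ring.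
Qed.

End HeatLowerBound.

(** * Integrals over the half-line dominated by two powers *)

Section PowerIntegrals.
Variable R : realType.
Notation mu := (@lebesgue_measure R).

Lemma powR_continuous_at (p t : R) : 0 < t -> {for t, continuous (@powR R ^~ p)}.
Proof.
move=> t0; apply: differentiable_continuous; apply/derivable1_diffP.
by have [] := is_derive1_powR p t0.
Qed.

Lemma integral_powR_itv (p a b : R) : p != 0 -> 0 < a -> a < b ->
  (\int[mu]_(t in `[a, b]) (t `^ (p - 1))%:E = ((b `^ p - a `^ p) / p)%:E)%E.
Proof.
move=> p0 a0 ab; pose F (t : R) := p^-1 * t `^ p.
have cF (t : R) : 0 < t -> {for t, continuous F}.
  by move=> t0; apply: cvgM; [exact: cvg_cst|exact: powR_continuous_at].
rewrite (@continuous_FTC2 _ _ F a b ab); last 3 first.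
- apply/continuous_within_itvP => //; split.
  + by move=> t /[!in_itv]/= /andP[/(lt_trans a0) t0 _]; exact: powR_continuous_at.
  + exact/cvg_at_right_filter/powR_continuous_at.
  + exact/cvg_at_left_filter/powR_continuous_at/(lt_trans a0).
- split.
  + move=> t /[!in_itv]/= /andP[/(lt_trans a0) t0 _].
    by apply: derivableM => //; have [] := is_derive1_powR p t0.
  + exact/cvg_at_right_filter/cF.
  + exact/cvg_at_left_filter/cF/(lt_trans a0).
- move=> t /[!in_itv]/= /andP[/(lt_trans a0) t0 _].
  have D : is_derive t 1 F (p^-1 *: (p * t `^ (p - 1))).
    exact: (is_deriveZ p^-1 (is_derive1_powR p t0)).
  by rewrite derive1E derive_val /GRing.scale /= mulrA mulVf ?mul1r.
by rewrite -EFinB /F -mulrBr mulrC.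
Qed.

Lemma ge0_integral_itvoy_le (g : R -> R) (T B : R) : 0 < T ->
  measurable_fun (`]0%R, +oo[ : set R) g -> (forall t, 0 < t -> 0 <= g t) ->
  (forall a b, 0 < a -> a < T -> T < b -> (\int[mu]_(t in `[a, b]) (g t)%:E <= B%:E)%E) ->
  (\int[mu]_(t in `]0%R, +oo[) (g t)%:E <= B%:E)%E.
Proof.
move=> T0 mg g0 gB.
(* With [n.+2] the endpoints lie strictly on either side of [T] already for [n = 0]. *)
pose F (n : nat) : set R := `[T / n.+2%:R, T * n.+2%:R]%classic.
have n0 n : (0 : R) < n.+2%:R by rewrite ltr0n.
have n1 n : (1 : R) < n.+2%:R by rewrite ltr1n.
have Fsub n : F n `<=` (`]0%R, +oo[ : set R).
  move=> t; rewrite /F /= !in_itv /= andbT => /andP[+ _].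
  by apply: lt_le_trans; rewrite divr_gt0.
have mF n : measurable (F n) by exact: measurable_itv.
have mgE : measurable_fun (`]0%R, +oo[ : set R) (EFin \o g) by exact/measurable_EFinP.
have ndF : nondecreasing_seq F.
  apply/nondecreasing_seqP => n; apply/subsetPset => t; rewrite /F /= !in_itv /= => /andP[h1 h2].
  apply/andP; split.
    apply: le_trans h1; rewrite ler_pM2l// lef_pV2 ?posrE// ler_nat; exact: leqnSn.
  by apply: (le_trans h2); rewrite ler_pM2l// ler_nat leqnSn.
have FU : \bigcup_n F n = `]0, +oo[%classic.
  apply/seteqP; split => [t [n _ /Fsub]//|t]; rewrite /= in_itv /= andbT => t0.
  (* The sum dominates both ratios, so a single index handles either endpoint. *)
  pose m := Num.truncn (T / t + t / T).
  exists m => //; rewrite /F /= in_itv /=.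
  have h0 : 0 <= T / t + t / T by rewrite addr_ge0// divr_ge0// ltW.
  have /andP[_ hm] := truncn_itv h0; rewrite -/m in hm.
  have h1 : T / t + t / T < m.+2%:R by rewrite (lt_trans hm)// ltr_nat.
  have tT : 0 < t / T by rewrite divr_gt0.
  have Tt : 0 < T / t by rewrite divr_gt0.
  rewrite ler_pdivrMr// mulrC -ler_pdivrMr// mulrC [T * _]mulrC -ler_pdivrMr//.
  by apply/andP; split; apply/ltW; lra.
have mgF n : measurable_fun (F n) (EFin \o g).
  by apply: measurable_funS mgE => //; exact: Fsub.
have gF n t : F n t -> (0 <= (EFin \o g) t)%E.
  by move/Fsub; rewrite /= in_itv /= andbT lee_fin => /g0.
have cv := ge0_nondecreasing_set_cvg_integral (mu := mu) ndF mF mgF gF.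
rewrite -FU -(cvg_lim _ cv)//; apply: lime_le; first exact: cvgP cv.
apply: nearW => n; apply: gB; rewrite ?divr_gt0//.
  by rewrite ltr_pdivrMr// ltr_pMr.
by rewrite ltr_pMr.
Qed.

(** The linear bound near 0 tames the singularity since [sigma < 1]; growth slower than [t ^ sigma]
    gives convergence at infinity. The cut [T] stays free and is later matched to the spatial
    scale. *)
Lemma integral_two_powers_le (sigma tau T A B : R) (f : R -> R) :
  sigma < 1 -> tau < sigma -> 0 < T -> 0 <= A -> 0 <= B ->
  measurable_fun (`]0%R, +oo[ : set R) f -> (forall t, 0 < t -> 0 <= f t) ->
  (forall t, 0 < t -> t <= T -> f t <= A * t) ->
  (forall t, T <= t -> f t <= B * t `^ tau) ->
  (\int[mu]_(t in `]0%R, +oo[) (f t * t `^ (- (1 + sigma)))%:E <=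
   (A * T `^ (1 - sigma) / (1 - sigma) + B * T `^ (tau - sigma) / (sigma - tau))%:E)%E.
Proof.
move=> s1 ts T0 A0 B0 mf f0 fA fB.
pose g t := f t * t `^ (- (1 + sigma)).
have mg : measurable_fun (`]0%R, +oo[ : set R) g.
  apply: measurable_funM => //.
  by apply: measurable_funTS; exact: measurable_powR.
have g0 t : 0 < t -> 0 <= g t by move=> t0; rewrite /g mulr_ge0 ?f0 ?powR_ge0.
apply: (@ge0_integral_itvoy_le g T _ T0 mg g0) => a b a0 aT Tb.
have mpow p : measurable_fun [set: R] (fun t : R => t `^ p) by exact: measurable_powR.
have mgab (i : interval R) : [set` i] `<=` (`]0%R, +oo[ : set R) -> measurable_fun [set` i] (EFin \o g).
  by move=> iS; apply/measurable_EFinP; exact: measurable_funS mg.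
have sub1 : `[a, T] `<=` (`]0, +oo[ : set R).
  by move=> t; rewrite /= !in_itv /= andbT => /andP[at0 _]; exact: lt_le_trans at0.
have sub2 : `[T, b] `<=` (`]0, +oo[ : set R).
  by move=> t; rewrite /= !in_itv /= andbT => /andP[at0 _]; exact: lt_le_trans at0.
have sub3 : `]T, b] `<=` (`[T, b] : set R).
  by move=> t; rewrite /= !in_itv /= => /andP[/ltW -> ->].
have itvU : `[a, b]%classic = `[a, T]%classic `|` `]T, b]%classic :> set R.
  apply/seteqP; split=> t; rewrite /= !in_itv /=.
    by move=> /andP[-> ->]; rewrite andbT; case: leP => _; [left|right].
  by move=> [/andP[-> h]|/andP[h ->]]; [exact: le_trans h (ltW Tb)|rewrite andbT ltW// (lt_trans aT)].
have -> : (\int[mu]_(t in `[a, b]) (g t)%:E =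
    \int[mu]_(t in `[a, T]) (g t)%:E + \int[mu]_(t in `]T, b]) (g t)%:E)%E.
  rewrite itvU ge0_integral_setU//.
  - rewrite -itvU; apply: mgab => t; rewrite /= !in_itv /= andbT => /andP[at0 _].
    exact: lt_le_trans at0.
  - move=> t h; rewrite lee_fin g0//; case: h => [/sub1|/sub3/sub2]; by rewrite /= in_itv /= andbT.
  - apply/disj_setPS => t [] /=; rewrite !in_itv /= => /andP[_ h1] /andP[h2 _].
    by move: (le_lt_trans h1 h2); rewrite ltxx.
have scale (c p x y : R) : 0 <= c -> p != 0 -> 0 < x -> x < y ->
    (\int[mu]_(t in `[x, y]) (c * t `^ (p - 1))%:E = (c * ((y `^ p - x `^ p) / p))%:E)%E.
  move=> c0 p0 x0 xy; under eq_integral do rewrite EFinM.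
  rewrite ge0_integralZl//.
  - by rewrite integral_powR_itv.
  - by apply/measurable_EFinP; apply: measurable_funTS; exact: mpow.
  - by move=> t _; rewrite lee_fin powR_ge0.
have mc (i : interval R) (c p : R) : measurable_fun [set` i] (fun t => (c * t `^ p)%:E).
  by apply/measurable_EFinP; apply: measurable_funTS; apply: measurable_funM.
rewrite EFinD; apply: leeD.
  apply: (@le_trans _ _ (\int[mu]_(t in `[a, T]) (A * t `^ ((1 - sigma) - 1))%:E)%E).
    apply: ge0_le_integral => //.
    - by move=> t /sub1; rewrite /= in_itv /= andbT lee_fin; exact: g0.
    - exact: mgab.
    - exact: mc.
    - move=> t tI; have := sub1 t tI; move: tI; rewrite /= !in_itv /= andbT => /andP[_ tT] t0.
      rewrite lee_fin /g; apply: (le_trans (ler_wpM2r (powR_ge0 _ _) (fA _ t0 tT))).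
      rewrite -mulrA ler_wpM2l// -{1}[t]powRr1 ?(ltW t0)// -powRD ?(gt_eqF t0) ?implybT//.
      by rewrite le_eqVlt; apply/orP; left; apply/eqP; congr (_ `^ _); ring.
  rewrite scale//; last by rewrite gt_eqF// subr_gt0.
  rewrite lee_fin -mulrA ler_wpM2l// ler_wpM2r ?invr_ge0 ?subr_ge0 ?(ltW s1)//.
  by rewrite gerBl powR_ge0.
apply: (@le_trans _ _ (\int[mu]_(t in `[T, b]) (g t)%:E)%E).
  apply: ge0_subset_integral => //; first exact: mgab.
  by move=> t /sub2; rewrite /= in_itv /= andbT lee_fin; exact: g0.
apply: (@le_trans _ _ (\int[mu]_(t in `[T, b]) (B * t `^ ((tau - sigma) - 1))%:E)%E).
  apply: ge0_le_integral => //.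
  - by move=> t /sub2; rewrite /= in_itv /= andbT lee_fin; exact: g0.
  - exact: mgab.
  - exact: mc.
  - move=> t tI; have := sub2 t tI; move: tI; rewrite /= !in_itv /= andbT => /andP[tT _] t0.
    rewrite lee_fin /g; apply: (le_trans (ler_wpM2r (powR_ge0 _ _) (fB _ tT))).
    rewrite -mulrA ler_wpM2l// -powRD ?(gt_eqF t0) ?implybT//.
    by rewrite le_eqVlt; apply/orP; left; apply/eqP; congr (_ `^ _); ring.
rewrite scale//; last by rewrite lt_eqF// subr_lt0.
rewrite -opprB -[X in _ / X]opprB invrN mulrNN.
rewrite lee_fin -mulrA ler_wpM2l// ler_wpM2r ?invr_ge0 ?subr_ge0 ?(ltW ts)//.
by rewrite gerBl powR_ge0.
Qed.

End PowerIntegrals.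

(** * Measurability and symmetry of the heat kernel, norm comparisons *)

Section KernelPreliminaries.
Variables (R : realType) (d : nat).
Notation mu := (@lebesgue_measure R).
Notation Zd := 'rV[int]_d.
Implicit Types x z : Zd.

Lemma ge0_integral_ge (g : R -> R) (a b c : R) : 0 < a -> a < b -> 0 <= c ->
  measurable_fun (`]0%R, +oo[ : set R) g -> (forall t, 0 < t -> 0 <= g t) ->
  (forall t, a <= t <= b -> c <= g t) ->
  ((c * (b - a))%:E <= \int[mu]_(t in `]0%R, +oo[) (g t)%:E)%E.
Proof.
move=> a0 ab c0 mg g0 cg.
have mgE : measurable_fun (`]0%R, +oo[ : set R) (EFin \o g) by exact/measurable_EFinP.
have sub : `[a, b] `<=` (`]0%R, +oo[ : set R).
  by move=> t; rewrite /= !in_itv /= andbT => /andP[at0 _]; exact: lt_le_trans at0.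
apply: (@le_trans _ _ (\int[mu]_(t in `[a, b]) (g t)%:E)%E); last first.
  apply: ge0_subset_integral => //.
  by move=> t; rewrite /= in_itv /= andbT lee_fin => /g0.
have -> : (c * (b - a))%:E = (\int[mu]_(t in `[a, b]) (cst c%:E) t)%E.
  by rewrite integral_cst//= lebesgue_measure_itv /= lte_fin ab EFinM.
apply: ge0_le_integral => //.
- by apply: measurable_funS mgE => //.
Qed.

Lemma measurable_heat x : measurable_fun (`]0%R, +oo[ : set R) (fun t => heat t x).
Proof.
apply: (measurable_fun_cvg
  (h := fun M (t : R) => \sum_(n < M) ((- t) ^+ n / n`!%:R * lapn n (@ind0 R d) x))).
  move=> M; apply: measurable_sum => n; apply: measurable_funM => //.
  apply: measurable_funM => //; apply: measurable_funX.
  by apply: measurableT_comp; [exact: oppr_measurable|].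
move=> t; rewrite /= in_itv /= andbT => t0; rewrite heatE ?(ltW t0)//.
by apply: heat_partial_cvg; exact: ltW.
Qed.

Lemma lapn_ind0N n x : lapn n (@ind0 R d) (- x) = lapn n (@ind0 R d) x.
Proof.
elim: n x => [|n IH] x; first by rewrite /lapn /= /ind0 oppr_eq0.
have lapS y : lapn n.+1 (@ind0 R d) y = lap (lapn n (@ind0 R d)) y by [].
rewrite !lapS /lap; apply: eq_bigr => i _.
have -> : - x + unitZ i = - (x - unitZ i) by rewrite opprB addrC.
by rewrite -opprD !IH addrC.
Qed.

Lemma normsq_ge1 z : z != 0 -> 1 <= normsq R z.
Proof.
move=> z0; have [i zi] : exists i, z 0 i != 0.
  apply/existsP; apply: contraNT z0; rewrite negb_exists => /forallP h.
  by apply/eqP/rowP => i; rewrite mxE; apply/eqP; have := h i; rewrite negbK.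
rewrite /normsq (bigD1 i)//= -[leLHS]addr0 lerD ?sumr_ge0//; last by move=> *; rewrite sqr_ge0.
rewrite -rmorphXn /= -[1]/(1%:~R) ler_int.
move: (z 0 i) zi => a a0; nia.
Qed.

Lemma supn_sqr_le z : (supn z)%:R ^+ 2 <= normsq R z.
Proof.
have [->|z0] := eqVneq z 0; first by rewrite supn0 expr0n /= normsq_ge0.
have [d0|d0] := posnP d.
  by move: z z0; rewrite d0 => z /eqP[]; apply/rowP => -[].
have [i ->] : exists i, supn z = `|z 0%R i|%N.
  have [|i e] := @bigop.eq_bigmax 'I_d (fun i => `|z 0%R i|%N); first by rewrite card_ord.
  by exists i.
rewrite /normsq (bigD1 i)//= -[leLHS]addr0 lerD ?sumr_ge0//; last by move=> *; rewrite sqr_ge0.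
by rewrite natr_absz intr_norm real_normK ?num_real.
Qed.

Lemma boxsum_heat_le1 N (t : R) (w : Zd -> R) : 0 <= t -> (forall z, 0 <= w z <= 1) ->
  boxsum N (fun z => heat t z * w z) <= 1.
Proof.
move=> t0 w1; have := @boxsum_heat_le R d N t w 1 0 t0 ler01 (lexx 0).
by rewrite mul0r addr0 => H; apply: H => z; rewrite mul0r addr0.
Qed.

End KernelPreliminaries.

(** * The Riesz kernel: finiteness and the basic weighted sum *)

Section Kernel.
Variables (R : realType) (d : nat) (sigma : R).
Hypotheses (sigma_gt0 : 0 < sigma) (sigma_lt1 : sigma < 1).
Notation mu := (@lebesgue_measure R).
Notation Zd := 'rV[int]_d.
Implicit Types x z : Zd.

Let kint x : \bar R :=
  (\int[mu]_(t in `]0%R, +oo[) (heat t x * t `^ (- (1 + sigma)))%:E)%E.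

(** Finiteness matters as much as positivity: [fine] sends an infinite integral to 0. Writing the
    integrand as [t * expR (- t)] times [t ^ (- (1 + sigma))] makes the two-power estimate apply
    with [tau = 0]. *)
Lemma Gamma_gt0 : 0 < Gamma (1 - sigma).
Proof.
pose f (t : R) := t * expR (- t).
pose I := (\int[mu]_(t in `]0%R, +oo[) (f t * t `^ (- (1 + sigma)))%:E)%E.
have mf : measurable_fun (`]0%R, +oo[ : set R) f.
  apply: measurable_funM => //; apply: measurable_funTS.
  by apply: measurableT_comp => //; exact: measurable_expR.
have mg : measurable_fun (`]0%R, +oo[ : set R) (fun t => f t * t `^ (- (1 + sigma))).
  by apply: measurable_funM => //; apply: measurable_funTS; exact: measurable_powR.
have f0 t : 0 < t -> 0 <= f t by move=> t0; rewrite mulr_ge0 ?expR_ge0 ?(ltW t0).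
have -> : Gamma (1 - sigma) = fine I.
  congr fine; apply: eq_integral => t; rewrite inE /= in_itv /= andbT => t0.
  rewrite /f mulrAC; congr ((_ * _)%:E).
  rewrite -{2}[t]powRr1 ?(ltW t0)// -powRD ?(gt_eqF t0) ?implybT//.
  by congr (_ `^ _); ring.
have Ile : (I <= (1 * 1 `^ (1 - sigma) / (1 - sigma) + 1 * 1 `^ (0 - sigma) / (sigma - 0))%:E)%E.
  apply: integral_two_powers_le => //.
    move=> t t0 _; rewrite /f mulrC ler_wpM2r ?(ltW t0)//.
    by rewrite -[leRHS]expR0 ler_expR oppr_le0 ltW.
  move=> t t1; rewrite powRr0 mulr1 /f expRN ler_pdivrMr ?expR_gt0// mul1r.
  by apply: le_trans (expR_ge1Dx t); rewrite lerDr.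
have Ige : ((expR (- 2) * 2 `^ (- (1 + sigma)) * (2 - 1))%:E <= I)%E.
  apply: ge0_integral_ge => //.
  - by lra.
  - by move=> t t0; rewrite mulr_ge0 ?f0 ?powR_ge0.
  - move=> t /andP[t1 t2]; have t0 : 0 < t by lra.
    rewrite ler_pM ?expR_ge0 ?powR_ge0//.
      rewrite /f -[leLHS]mul1r ler_pM ?expR_ge0// ler_expR; lra.
    rewrite !powRN lef_pV2 ?posrE ?powR_gt0//.
    by rewrite ge0_ler_powR ?nnegrE ?(ltW t0)// addr_ge0// ltW.
have pos : 0 < expR (-2) * 2 `^ (- (1 + sigma)) * (2 - 1) :> R.
  by rewrite !mulr_gt0 ?expR_gt0 ?powR_gt0//; lra.
rewrite fine_gt0//; apply/andP; split.
  by apply: lt_le_trans Ige; rewrite lte_fin.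
by apply: le_lt_trans Ile _; rewrite ltry.
Qed.

Lemma absGammaNeg_gt0 : 0 < absGammaNeg sigma.
Proof. by rewrite divr_gt0// Gamma_gt0. Qed.

Lemma kappaN x : kappa sigma (- x) = kappa sigma x.
Proof.
rewrite /kappa oppr_eq0; case: ifP => // _; congr (_ * fine _).
apply: eq_integral => t _; congr ((_ * _)%:E).
by rewrite /heat; congr (limn _); apply/funext => M; apply: eq_bigr => n _; rewrite lapn_ind0N.
Qed.

Lemma measurable_kint x :
  measurable_fun (`]0%R, +oo[ : set R) (fun t => heat t x * t `^ (- (1 + sigma))).
Proof.
apply: measurable_funM; first exact: measurable_heat.
by apply: measurable_funTS; exact: measurable_powR.
Qed.

(** Stated in extended reals because finiteness of [kint] is itself deduced from it, with an
    indicator as weight. Small times are controlled by the second moment, large times by the assumed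
    bound. *)
Lemma sum_kint_le (w : Zd -> R) (A B T tau : R) N : 0 <= A -> 0 <= B -> 0 < T ->
  tau < sigma -> (forall z, 0 <= w z <= A * normsq R z) ->
  (forall t, T <= t -> boxsum N (fun z => heat t z * w z) <= B * t `^ tau) ->
  (\sum_(z <- boxseq d N) (w z)%:E * kint z <=
   (A * (2 * d%:R) * T `^ (1 - sigma) / (1 - sigma) + B * T `^ (tau - sigma) / (sigma - tau))%:E)%E.
Proof.
move=> A0 B0 T0 ts wA wB.
have w0 z : 0 <= w z by have /andP[] := wA z.
have mh z : measurable_fun (`]0%R, +oo[ : set R) (fun t => heat t z * w z).
  by apply: measurable_funM => //; exact: measurable_heat.
have -> : (\sum_(z <- boxseq d N) (w z)%:E * kint z =
  \int[mu]_(t in `]0%R, +oo[) (boxsum N (fun z => heat t z * w z) * t `^ (- (1 + sigma)))%:E)%E.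
  under eq_bigr => z _.
    rewrite /kint -ge0_integralZl//; last 3 first.
    - by apply/measurable_EFinP; exact: measurable_kint.
    - move=> t; rewrite /= in_itv /= andbT => t0.
      by rewrite lee_fin mulr_ge0 ?powR_ge0 ?heat_ge0 ?(ltW t0).
    - by rewrite lee_fin.
    over.
  rewrite -ge0_integral_sum//; last 2 first.
  - move=> z; apply: measurable_funeM; apply/measurable_EFinP; exact: measurable_kint.
  - move=> z t; rewrite /= in_itv /= andbT => t0.
    by rewrite -EFinM lee_fin !mulr_ge0 ?powR_ge0 ?heat_ge0 ?(ltW t0).
  apply: eq_integral => t _; rewrite boxsumE mulr_suml -sumEFin; apply: eq_bigr => z _.
  by rewrite -EFinM; congr (_%:E); ring.
apply: integral_two_powers_le => //.
- by rewrite !mulr_ge0.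
- by apply: measurable_sum => k; exact: mh.
- by move=> t t0; apply: boxsum_ge0 => z; rewrite mulr_ge0 ?heat_ge0 ?(ltW t0).
- move=> t t0 _; rewrite -mulrA -[leRHS]add0r.
  by apply: boxsum_heat_le; rewrite ?(ltW t0)// => z; rewrite add0r.
Qed.

Lemma kint_fin x : x != 0 -> kint x \is a fin_num.
Proof.
move=> x0; pose w z : R := (z == x)%:R.
have := @sum_kint_le w 1 1 1 0 (supn x) ler01 ler01 ltr01 sigma_gt0.
rewrite ge0_fin_numE; last first.
  apply: integral_ge0 => t; rewrite /= in_itv /= andbT => t0.
  by rewrite lee_fin mulr_ge0 ?powR_ge0 ?heat_ge0 ?(ltW t0).
move=> H; apply: le_lt_trans (le_lt_trans (H _ _) (ltry _)).
- rewrite (bigD1_seq x) ?boxseq_uniq ?mem_boxseq//= /w eqxx mul1e big1 ?adde0//.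
  by move=> z /negbTE ->; rewrite mul0e.
- move=> z; rewrite /w ler0n mul1r; case: eqP => [->|_]; first exact: normsq_ge1.
  exact: normsq_ge0.
- move=> t t1; rewrite powRr0 mulr1; apply: boxsum_heat_le1; first exact: le_trans t1.
  by move=> z; rewrite /w ler0n lern1; case: eqP.
Qed.

Lemma kappaE x : x != 0 -> (kappa sigma x)%:E = ((absGammaNeg sigma)^-1%:E * kint x)%E.
Proof.
by move=> x0; rewrite /kappa (negbTE x0) EFinM -/(kint x) fineK// kint_fin.
Qed.

Lemma kappa_ge0 x : 0 <= kappa sigma x.
Proof.
rewrite /kappa; case: ifP => // _; rewrite mulr_ge0 ?invr_ge0 ?(ltW absGammaNeg_gt0)//.
apply: fine_ge0; apply: integral_ge0 => t; rewrite /= in_itv /= andbT => t0.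
by rewrite lee_fin mulr_ge0 ?powR_ge0 ?heat_ge0 ?(ltW t0).
Qed.

Lemma boxsum_kappa_le (w : Zd -> R) (A B T tau : R) N : 0 <= A -> 0 <= B -> 0 < T ->
  tau < sigma -> (forall z, 0 <= w z <= A * normsq R z) ->
  (forall t, T <= t -> boxsum N (fun z => heat t z * w z) <= B * t `^ tau) ->
  boxsum N (fun z => kappa sigma z * w z) <= (absGammaNeg sigma)^-1 *
   (A * (2 * d%:R) * T `^ (1 - sigma) / (1 - sigma) + B * T `^ (tau - sigma) / (sigma - tau)).
Proof.
move=> A0 B0 T0 ts wA wB; have H := sum_kint_le A0 B0 T0 ts wA wB.
have c0 : 0 < (absGammaNeg sigma)^-1 by rewrite invr_gt0 absGammaNeg_gt0.
rewrite -lee_fin EFinM boxsumE -sumEFin.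
apply: le_trans (lee_wpmul2l _ H); last by rewrite lee_fin ltW.
rewrite ge0_sume_distrr; last first.
  move=> z _; rewrite mule_ge0//; first by rewrite lee_fin; have /andP[] := wA z.
  apply: integral_ge0 => t; rewrite /= in_itv /= andbT => t0.
  by rewrite lee_fin mulr_ge0 ?powR_ge0 ?heat_ge0 ?(ltW t0).
apply: lee_sum => z _; have [->|z0] := eqVneq z 0.
  have -> : w 0 = 0.
    apply/eqP; rewrite eq_le; have /andP[-> h] := wA 0; rewrite andbT (le_trans h)//.
    by rewrite /normsq big1 ?mulr0// => i _; rewrite mxE expr0n.
  by rewrite mulr0 mul0e mule0.
by rewrite EFinM kappaE// -muleA [(kint z * _)%E]muleC.
Qed.

End Kernel.

(** * Total mass, logarithmic moment and lower bound of the Riesz kernel *)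

Section KernelBounds.
Variables (R : realType) (d : nat) (sigma : R).
Hypotheses (sigma_gt0 : 0 < sigma) (sigma_lt1 : sigma < 1).
Notation Zd := 'rV[int]_d.
Implicit Types x z : Zd.

Lemma kappa_total : exists K : R, 0 <= K /\ forall N, boxsum N (@kappa R d sigma) <= K.
Proof.
pose w z : R := (z != 0)%:R.
have w1 z : 0 <= w z <= 1 by rewrite /w ler0n lern1; case: eqP.
pose K := (absGammaNeg sigma)^-1 *
  (1 * (2 * d%:R) * 1 `^ (1 - sigma) / (1 - sigma) + 1 * 1 `^ (0 - sigma) / (sigma - 0)).
have H N : boxsum N (@kappa R d sigma) <= K.
  apply: (@le_trans _ _ (boxsum N (fun z => kappa sigma z * w z))).
    apply: ler_boxsum => z _; rewrite /w; case: eqP => [->|]; last by rewrite mulr1.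
    by rewrite mulr0 /kappa eqxx.
  apply: boxsum_kappa_le => //.
    move=> z; rewrite mul1r /w; case: eqP => [->|/eqP z0]; first by rewrite lexx normsq_ge0.
    by rewrite ler01 normsq_ge1.
  move=> t t1; rewrite powRr0 mulr1; apply: boxsum_heat_le1 => //; exact: le_trans t1.
exists K; split => //; apply: le_trans (H 0%N).
by apply: boxsum_ge0 => z; exact: kappa_ge0.
Qed.

(** A weak form of the tangent line bound for a concave power. It replaces Jensen's inequality: a
    fractional moment is majorised by an affine function of the second moment. *)
Lemma powR_le_tangent (p q y : R) : 0 < p < 1 -> 0 < q -> 0 <= y ->
  y `^ p <= q `^ p + q `^ (p - 1) * y.
Proof.
move=> /andP[p0 p1] q0 y0; have [yq|qy] := leP y q.
  rewrite -[leLHS]addr0 lerD ?mulr_ge0 ?powR_ge0//.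
  by rewrite ge0_ler_powR ?nnegrE ?(ltW p0)// ltW.
have yp : 0 < y := lt_trans q0 qy.
rewrite -[leLHS]add0r lerD ?powR_ge0//.
have -> : y `^ p = y `^ (p - 1) * y.
  by rewrite -{3}[y]powRr1// -powRD ?subrK// (gt_eqF yp) implybT.
rewrite ler_wpM2r// -opprB !powRN lef_pV2 ?posrE ?powR_gt0//.
by rewrite ge0_ler_powR ?nnegrE ?(ltW q0) ?(ltW qy) ?y0 ?subr_ge0 ?(ltW p1).
Qed.

Lemma ln_sqr_le (p s : R) : 0 < p -> 0 <= s -> ln (1 + s) ^+ 2 <= p ^- 2 * ((1 + s) ^+ 2) `^ p.
Proof.
move=> p0 s0; have s1 : 0 < 1 + s by lra.
have -> : ((1 + s) ^+ 2) `^ p = ((1 + s) `^ p) ^+ 2.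
  by rewrite -!powR_mulrn ?powR_ge0 ?ltW// -!powRrM mulrC.
rewrite -exprVn -exprMn lerXn2r ?nnegrE ?ln_ge0 ?mulr_ge0 ?invr_ge0 ?powR_ge0 ?(ltW p0)//; first lra.
rewrite mulrC ler_pdivlMr// mulrC -ln_powR.
by apply/ltW/ln_sublinear; rewrite powR_gt0.
Qed.

(** Time is cut at [T = r ^ 2]. Below, [ln (1 + s) <= s] and the second moment suffice. Above,
    [ln ^ 2] is bounded by a power [p = sigma / 2] of [(1 + s) ^ 2], linearised at [q = t / T]; this
    grows like [t ^ p] with [p < sigma]. Both parts scale as [T ^ (- sigma)]. *)
Lemma kappa_log : exists C : R, 0 <= C /\ forall (r : R) N, 1 <= r ->
  boxsum N (fun z => kappa sigma z * ln (1 + (supn z)%:R / r) ^+ 2) <= C * (r ^+ 2) `^ (- sigma).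
Proof.
pose p := sigma / 2; have p0 : 0 < p by rewrite /p divr_gt0.
have p1 : p < 1 by rewrite /p; move: sigma_lt1; lra.
have ps : p < sigma by rewrite /p; move: sigma_gt0; lra.
(* From [q ^ p + 2 q ^ (p - 1) + 4 d q ^ p] with [q >= 1]: the bound [(1 + s) ^ 2 <= 2 + 2 s ^ 2]
   gives both factors 2, and the second moment multiplies the last by [2 d]. *)
pose B0 : R := p ^- 2 * (3 + 4 * d%:R).
have B00 : 0 <= B0 by rewrite /B0 mulr_ge0 ?invr_ge0 ?sqr_ge0// addr_ge0// mulr_ge0.
exists ((absGammaNeg sigma)^-1 * (2 * d%:R / (1 - sigma) + B0 / (sigma - p))); split.
  have h1 : 0 <= 2 * d%:R / (1 - sigma) by rewrite divr_ge0 ?mulr_ge0 ?subr_ge0 ?(ltW sigma_lt1).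
  have h2 : 0 <= B0 / (sigma - p) by rewrite divr_ge0// subr_ge0 ltW.
  apply: mulr_ge0; last exact: addr_ge0.
  by rewrite invr_ge0 ltW// absGammaNeg_gt0.
move=> r N r1; have r0 : 0 < r by lra.
set T := r ^+ 2; have T0 : 0 < T by rewrite exprn_gt0.
have s0 z : 0 <= (supn z)%:R / r by rewrite divr_ge0 ?(ltW r0).
have w0 z : 0 <= ln (1 + (supn z)%:R / r) ^+ 2 by rewrite sqr_ge0.
have sT z : ((supn z)%:R / r) ^+ 2 <= T^-1 * normsq R z.
  by rewrite expr_div_n mulrC ler_wpM2l ?invr_ge0 ?(ltW T0)// supn_sqr_le.
have T1 : T `^ (1 - sigma) = T * T `^ (- sigma).
  by rewrite powRD ?powRr1 ?(ltW T0)// (gt_eqF T0) implybT.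
have T2 : T `^ (- p) * T `^ (p - sigma) = T `^ (- sigma).
  by rewrite -powRD ?(gt_eqF T0) ?implybT//; congr (_ `^ _); ring.
have Ti : 0 <= T^-1 by rewrite invr_ge0 ltW.
have -> : (absGammaNeg sigma)^-1 * (2 * d%:R / (1 - sigma) + B0 / (sigma - p)) * T `^ (- sigma) =
  (absGammaNeg sigma)^-1 * (T^-1 * (2 * d%:R) * T `^ (1 - sigma) / (1 - sigma) +
     (B0 * T `^ (- p)) * T `^ (p - sigma) / (sigma - p)).
  rewrite -[B0 * _ * _]mulrA T2 T1; rewrite -mulrA; congr (_ * _).
  by field; rewrite subr_eq0 (gt_eqF ps) (gt_eqF T0) subr_eq0 (gt_eqF sigma_lt1).
apply: boxsum_kappa_le => //; first by rewrite mulr_ge0 ?powR_ge0.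
  move=> z; rewrite w0 (le_trans _ (sT z))//.
  rewrite lerXn2r ?nnegrE ?ln_ge0 ?lerDl//.
  by rewrite le_ln1Dx//; have := s0 z; lra.
move=> t tT; have t0 : 0 < t by lra.
pose q := t / T; have q1 : 1 <= q by rewrite /q ler_pdivlMr// mul1r.
have q0 : 0 < q by lra.
have -> : B0 * T `^ (- p) * t `^ p = B0 * q `^ p.
  rewrite -mulrA; congr (_ * _); have -> : t = q * T by rewrite /q divfK// gt_eqF.
  rewrite [(q * T) `^ p]powRM ?(ltW q0) ?(ltW T0)// mulrCA -powRD ?(gt_eqF T0) ?implybT//.
  by rewrite addNr powRr0 mulr1.
pose a := p ^- 2 * (q `^ p + 2 * q `^ (p - 1)); pose b := p ^- 2 * (2 * q `^ (p - 1) / T).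
have pp : 0 <= p ^- 2 by rewrite invr_ge0 sqr_ge0.
have a0 : 0 <= a by rewrite /a mulr_ge0// addr_ge0 ?mulr_ge0 ?powR_ge0.
have b0 : 0 <= b by rewrite /b !mulr_ge0 ?powR_ge0.
apply: (@le_trans _ _ (a + b * (2 * d%:R * t))).
  apply: boxsum_heat_le => //; first exact: ltW.
  move=> z; rewrite w0 (le_trans (ln_sqr_le p0 (s0 z)))//.
  have -> : a + b * normsq R z = p ^- 2 * (q `^ p + q `^ (p - 1) * (2 + 2 * (T^-1 * normsq R z))).
    by rewrite /a /b; ring.
  rewrite ler_wpM2l//.
  have p01 : 0 < p < 1 by rewrite p0 p1.
  apply: (le_trans (powR_le_tangent p01 q0 (sqr_ge0 _))).
  rewrite lerD2l ler_wpM2l ?powR_ge0//.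
  apply: (@le_trans _ _ (2 + 2 * ((supn z)%:R / r) ^+ 2)); last by rewrite lerD2l ler_pM2l.
  have := sqr_ge0 (1 - (supn z)%:R / r); rewrite !expr2; lra.
have qp : q `^ (p - 1) * q = q `^ p.
  by rewrite -{2}[q]powRr1 ?(ltW q0)// -powRD ?subrK// (gt_eqF q0) implybT.
have -> : a + b * (2 * d%:R * t) = p ^- 2 * (q `^ p + 2 * q `^ (p - 1) + 4 * d%:R * (q `^ (p - 1) * q)).
  by rewrite /a /b /q; field; rewrite (gt_eqF p0) (gt_eqF T0).
have qq : q `^ (p - 1) <= q `^ p by rewrite ler_powR//; lra.
rewrite qp /B0 -[leRHS]mulrA ler_wpM2l//.
have := @ler0n R d; lra.
Qed.

(** Only the times between [4 m ^ 2] and [8 m ^ 2] are kept, [m = supn x]. There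
    [2 m <= sqrt t <= 4 m], so [heat_lower] applies and its [8 * s] becomes [32 * m]; the factor 4
    in [C] comes from the length of the interval. *)
Lemma kappa_lower : exists C : R, 0 < C /\ forall x, x != 0 ->
  C * (supn x)%:R `^ (- (d%:R + 2 * sigma)) <= kappa sigma x.
Proof.
have c0 : 0 < (absGammaNeg sigma)^-1 by rewrite invr_gt0 absGammaNeg_gt0.
pose A : R := (expR (-10) / 32) ^+ d.
have A0 : 0 < A by rewrite exprn_gt0// divr_gt0 ?expR_gt0.
pose C := (absGammaNeg sigma)^-1 * (A * 8 `^ (- (1 + sigma)) * 4).
exists C; split; first by rewrite /C !mulr_gt0 ?powR_gt0.
move=> x x0; set m : R := (supn x)%:R.
have m1 : 1 <= m by rewrite /m ler1n lt0n supn_eq0.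
have m0 : 0 < m by lra.
rewrite -lee_fin kappaE//.
have mpow : m `^ (- (d%:R + 2 * sigma)) = m ^- d * (m ^+ 2) `^ (- (1 + sigma)) * m ^+ 2.
  rewrite -powR_invn ?(ltW m0)// -!powR_mulrn ?(ltW m0)// -powRrM -!powRD ?(gt_eqF m0) ?implybT//.
  by congr (_ `^ _); ring.
have -> : C * m `^ (- (d%:R + 2 * sigma)) = (absGammaNeg sigma)^-1 *
   (((expR (-10) / (32 * m)) ^+ d * (8 * m ^+ 2) `^ (- (1 + sigma))) * (8 * m ^+ 2 - 4 * m ^+ 2)).
  rewrite mpow powRM ?sqr_ge0// /C /A.
  have -> : (expR (-10) / (32 * m)) = expR (-10) / 32 / m by field; lra.
  rewrite [(_ / m) ^+ d]exprMn exprVn; ring.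
rewrite EFinM; apply: lee_wpmul2l; first by rewrite lee_fin ltW.
apply: ge0_integral_ge.
- by rewrite mulr_gt0// exprn_gt0.
- by rewrite ltr_pM2r ?exprn_gt0//; lra.
- by rewrite mulr_ge0 ?powR_ge0// exprn_ge0// divr_ge0 ?expR_ge0//; lra.
- exact: measurable_kint.
- by move=> t t0; rewrite mulr_ge0 ?powR_ge0 ?heat_ge0 ?ltW.
- move=> t /andP[t4 t8].
  have t0 : 0 < t by apply: lt_le_trans t4; rewrite mulr_gt0// exprn_gt0.
  have mm : m ^+ 2 = m * m by rewrite expr2.
  have s2m : 2 * m <= Num.sqrt t.
    rewrite -[leLHS]ger0_norm; last by lra.
    by rewrite -sqrtr_sqr ler_wsqrtr// exprMn; lra.
  have s4m : Num.sqrt t <= 4 * m.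
    rewrite -[leRHS]ger0_norm; last by lra.
    rewrite -sqrtr_sqr ler_wsqrtr// exprMn; have := sqr_ge0 m; lra.
  rewrite ler_pM ?powR_ge0//.
  + by rewrite exprn_ge0// divr_ge0 ?expR_ge0//; lra.
  + rewrite -{1}[t]sqr_sqrtr ?(ltW t0)//.
    apply: (le_trans _ (heat_lower (s := Num.sqrt t) _ _)); last 2 first.
      lra.
      rewrite -/m; lra.
    rewrite lerXn2r ?nnegrE ?divr_ge0 ?expR_ge0//; try lra.
    rewrite ler_wpM2l ?expR_ge0// lef_pV2 ?posrE; lra.
  + rewrite !powRN lef_pV2 ?posrE ?powR_gt0//; last by lra.
    by rewrite ge0_ler_powR ?nnegrE ?(ltW t0)//; move: sigma_gt0; lra.
Qed.

End KernelBounds.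

(** * Logarithmic cutoffs and the critical weight *)

Section Liouville.
Variables (R : realType) (d : nat).
Notation Zd := 'rV[int]_d.
Implicit Types x y z a b : Zd.

(* A null sequence for the critical Hardy weight [(1 + supn x) ^ (- d)]. *)
Definition logcut (m : nat) x : R :=
  Num.max 0 (1 - ln (1 + (supn x)%:R) / ln (2 ^+ m)).

Lemma logcut_ge0 m x : 0 <= logcut m x.
Proof. by rewrite /logcut le_max lexx. Qed.

Lemma ln_pow2_gt0 m : (0 < m)%N -> 0 < ln (2 ^+ m : R).
Proof. by move=> m0; rewrite ln_gt0// exprn_egt1// ?gt_eqF// ltr1n. Qed.

Lemma ln1supn_ge0 x : 0 <= ln (1 + (supn x)%:R : R).
Proof. by rewrite ln_ge0// lerDl. Qed.

Lemma logcut_le1 m x : (0 < m)%N -> logcut m x <= 1.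
Proof.
move=> m0; rewrite /logcut ge_max ler01 gerBl.
by rewrite divr_ge0 ?ln1supn_ge0// ltW// ln_pow2_gt0.
Qed.

Lemma logcut_eq0 m x : (0 < m)%N -> (2 ^ m <= 1 + supn x)%N -> logcut m x = 0.
Proof.
move=> m0 mx; apply/max_idPl; rewrite subr_le0 ler_pdivlMr ?ln_pow2_gt0// mul1r.
by rewrite ler_ln ?posrE ?exprn_gt0// -natrX nat1r ler_nat.
Qed.

(** By the triangle inequality [1 + supn y] exceeds [1 + supn x] at most by the factor
    [1 + supn (x - y) / (1 + supn x)]; truncation at 0 does not increase differences. The bound has
    the shape summed by [kappa_log] with [r = 1 + supn x]. *)
Lemma logcut_diff m x y : (0 < m)%N -> (supn x <= supn y)%N ->
  0 <= logcut m x - logcut m y <=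
    ln (1 + (supn (x - y))%:R / (1 + (supn x)%:R)) / ln (2 ^+ m).
Proof.
move=> m0 xy; have L0 := ln_pow2_gt0 m0; set L := ln _ in L0 *.
have px : 0 < 1 + (supn x)%:R :> R by [].
have py : 0 < 1 + (supn y)%:R :> R by [].
have lxy : ln (1 + (supn x)%:R) <= ln (1 + (supn y)%:R) :> R.
  by rewrite ler_ln ?posrE// lerD2l ler_nat.
have lyx : ln (1 + (supn y)%:R) - ln (1 + (supn x)%:R) <=
    ln (1 + (supn (x - y))%:R / (1 + (supn x)%:R)) :> R.
  have pz : 0 < 1 + (supn (x - y))%:R / (1 + (supn x)%:R) :> R.
    by rewrite (lt_le_trans ltr01)// lerDl divr_ge0.
  rewrite -ln_div ?posrE// ler_ln ?posrE ?divr_gt0//.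
  rewrite ler_pdivrMr// mulrDl mul1r divfK ?gt_eqF// -addrA lerD2l -natrD ler_nat.
  by have := supnD x (y - x); rewrite addrC subrK -opprB supnN.
have lxyL : ln (1 + (supn x)%:R) / L <= ln (1 + (supn y)%:R) / L :> R.
  by rewrite ler_pM2r// invr_gt0.
have lyxL : ln (1 + (supn y)%:R) / L - ln (1 + (supn x)%:R) / L <=
   ln (1 + (supn (x - y))%:R / (1 + (supn x)%:R)) / L :> R.
  by rewrite -mulrBl ler_pM2r// invr_gt0.
rewrite /logcut -/L; move: lxyL lyxL.
set X := ln (1 + (supn x)%:R) / L; set Y := ln (1 + (supn y)%:R) / L; set Z := ln _ / L.
move=> XY YX; rewrite /Num.max; case: ltP => h1; case: ltP => h2; apply/andP; split; lra.
Qed.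

(** Each dyadic shell contributes at most [8 ^ d]: it sits in a box of at most [(8 * 2 ^ m) ^ d]
    points, each of weight at most [(2 ^ m) ^ (- d)]. *)
Lemma boxsum_shell_le M m :
  boxsum M (fun x => if (1 + supn x < 2 ^ m)%N then ((1 + (supn x)%:R) ^+ d)^-1 else 0) <=
  8 ^+ d * m%:R :> R.
Proof.
elim: m => [|m IH].
  rewrite mulr0 /boxsum big1// => k _.
pose g x : R := if (supn x <= 2 ^ m.+1)%N then ((2 ^+ m) ^+ d)^-1 else 0.
have g0 x : 0 <= g x by rewrite /g; case: ifP => // _; rewrite invr_ge0 !exprn_ge0.
apply: (@le_trans _ _ (boxsum M (fun x =>
   (if (1 + supn x < 2 ^ m)%N then ((1 + (supn x)%:R) ^+ d)^-1 else 0) + g x))).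
  apply: ler_boxsum => x _; case: (ltnP (1 + supn x)) => h1; last first.
    by rewrite addr_ge0//; case: ifP => // _; rewrite invr_ge0 exprn_ge0// addr_ge0.
  case: (ltnP (1 + supn x) (2 ^ m)) => h2; first by rewrite lerDl.
  rewrite add0r /g ifT; last by rewrite (leq_trans _ (ltnW h1))// leq_addl.
  rewrite lef_pV2 ?posrE ?exprn_gt0// ?ltr_wpDr//.
  by rewrite lerXn2r ?nnegrE ?exprn_ge0 ?addr_ge0// -natrX nat1r ler_nat.
rewrite boxsumD -[m.+1%:R]natr1 mulrDr mulr1 lerD//.
apply: (@le_trans _ _ (boxsum (2 ^ m.+1) g)).
  have [ML|LM] := leqP M (2 ^ m.+1); first exact: boxsum_mono.
  rewrite (@boxsum_support _ _ (2 ^ m.+1)) ?(ltnW LM)// => x xM.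
  by rewrite /g leqNgt xM.
apply: (@le_trans _ _ (boxsum (2 ^ m.+1) (fun=> ((2 ^+ m) ^+ d)^-1))).
  by apply: ler_boxsum => x xM; rewrite /g xM.
rewrite boxsumE big_const_seq count_predT size_boxseq iter_addr_0 -[_ *+ _]mulr_natr mulrC.
rewrite ler_pdivrMr ?exprn_gt0// -exprMn natrX lerXn2r ?nnegrE ?mulr_ge0 ?exprn_ge0//.
rewrite -natrX -natrM ler_nat expnS -muln2.
have := expn_gt0 2 m; lia.
Qed.

End Liouville.

(** * From the Euclidean norm at infinity to a global bound in [supn] *)

Section NormComparison.
Variables (R : realType) (d : nat).
Notation Zd := 'rV[int]_d.
Implicit Types x : Zd.

Lemma supn_le_normZ x : (supn x)%:R <= normZ x :> R.
Proof.
rewrite -[leLHS]ger0_norm// -sqrtr_sqr ler_wsqrtr//; exact: supn_sqr_le.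
Qed.

Lemma normZ_le_supn x : normZ x <= d%:R * (supn x)%:R :> R.
Proof.
rewrite -[leRHS]ger0_norm ?mulr_ge0// -sqrtr_sqr ler_wsqrtr//.
apply: (@le_trans _ _ (\sum_(i < d) (supn x)%:R ^+ 2)).
  apply: ler_sum => i _; rewrite -real_normK ?num_real// -intr_norm -natr_absz.
  by rewrite lerXn2r ?nnegrE// ler_nat leq_supn.
rewrite sumr_const card_ord -[_ *+ d]mulr_natr exprMn mulrC ler_wpM2r ?sqr_ge0//.
by rewrite -natrX ler_nat; case: d => // n; rewrite leq_pmulr.
Qed.

Lemma bigO_decay (u : Zd -> R) (b : R) : 0 <= b ->
  bigO_infty u (fun x => normZ x `^ (- b)) ->
  exists C : R, 0 <= C /\ forall x, `|u x| <= C * (1 + (supn x)%:R) `^ (- b).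
Proof.
move=> b0 [C [r0 uC]]; pose M := (Num.truncn `|r0|).+1.
have rM : r0 <= M%:R.
  have /andP[_ /ltW h] := truncn_itv (normr_ge0 r0).
  exact: le_trans (ler_norm _) h.
pose S := boxsum M (fun x => `|u x|).
have S0 : 0 <= S by apply: boxsum_ge0.
have p1 x : 0 < 1 + (supn x)%:R :> R by rewrite nat1r.
exists (`|C| * 2 `^ b + S * (1 + M%:R) `^ b); split.
  by rewrite addr_ge0// mulr_ge0 ?powR_ge0.
move=> x; rewrite mulrDl; have [xM|Mx] := leqP (supn x) M.
  rewrite -[leLHS]add0r lerD ?mulr_ge0 ?powR_ge0//.
  apply: (@le_trans _ _ S); first exact: (boxsum_ge_term (g := fun x => `|u x|)).
  rewrite -mulrA ler_peMr// powRN ler_pdivlMr ?powR_gt0// mul1r.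
  by rewrite ge0_ler_powR ?nnegrE ?addr_ge0// lerD2l ler_nat.
rewrite -[leLHS]addr0 lerD ?mulr_ge0 ?powR_ge0//.
have sx : (supn x)%:R <= normZ x :> R := supn_le_normZ x.
have Msx : M%:R <= (supn x)%:R :> R by rewrite ler_nat ltnW.
apply: le_trans (uC x _) _; first lra.
rewrite ger0_norm ?powR_ge0//.
apply: (@le_trans _ _ (`|C| * normZ x `^ (- b))).
  by rewrite ler_wpM2r ?powR_ge0// ler_norm.
rewrite -mulrA ler_wpM2l// !powRN.
have s1 : 1 <= (supn x)%:R :> R by rewrite ler1n (leq_trans _ Mx).
have nx : 0 < normZ x :> R by lra.
rewrite ler_pdivlMr ?powR_gt0// mulrC ler_pdivrMr ?powR_gt0// -powRM ?(ltW nx)//.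
by rewrite ge0_ler_powR ?nnegrE ?mulr_ge0 ?(ltW nx) ?addr_ge0//; lra.
Qed.

End NormComparison.

(** * Energy of the cutoffs *)

Section Energy.
Variables (R : realType) (d : nat) (sigma : R).
Hypotheses (sigma_gt0 : 0 < sigma) (sigma_lt1 : sigma < 1).
Notation Zd := 'rV[int]_d.
Implicit Types x y : Zd.

Lemma logcut_energy (v : Zd -> R) (C : R) : sigma < d%:R / 2 -> 0 <= C ->
  (forall x, 0 <= v x <= C * (1 + (supn x)%:R) `^ (- (d%:R / 2 - sigma))) ->
  exists E : R, forall m M, (0 < m)%N ->
    boxsum M (fun x => boxsum M (fun y =>
      kappa sigma (x - y) * (v x * v y) * (logcut R m x - logcut R m y) ^+ 2)) <= E / m%:R.
Proof.
move=> sd C0 vC; set b := d%:R / 2 - sigma in vC.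
have b0 : 0 <= b by rewrite /b subr_ge0 ltW.
have [K [K0 HK]] := @kappa_log R d sigma sigma_gt0 sigma_lt1.
exists (2 * (C ^+ 2 * K * 8 ^+ d / ln 2 ^+ 2)) => m M m0.
have L0 := ln_pow2_gt0 R m0; set L := ln _ in L0.
pose r x : R := 1 + (supn x)%:R.
have r1 x : 1 <= r x by rewrite /r lerDl.
have r0 x : 0 < r x by rewrite (lt_le_trans ltr01).
pose F x y := kappa sigma (x - y) * (v x * v y) * (logcut R m x - logcut R m y) ^+ 2.
(* Majorant for pairs with [supn x <= supn y], using the decay at [x] for both values of [v]. If
   [supn x] is beyond the support, so is [supn y], and the difference is 0. The pairs in the other
   order cost the factor 2 in front of the constant. *)
pose G x y := if (1 + supn x < 2 ^ m)%N then
  kappa sigma (x - y) * (C ^+ 2 * (r x `^ (- b)) ^+ 2 / L ^+ 2 *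
    ln (1 + (supn (x - y))%:R / r x) ^+ 2) else 0.
have k0 x : 0 <= kappa sigma x by apply: kappa_ge0.
have G0 x y : 0 <= G x y.
  rewrite /G; case: ifP => // _; rewrite mulr_ge0// mulr_ge0 ?sqr_ge0// divr_ge0 ?sqr_ge0//.
  by rewrite mulr_ge0 ?sqr_ge0.
have v0 x : 0 <= v x by have /andP[] := vC x.
have FG x y : (supn x <= supn y)%N -> F x y <= G x y.
  move=> xy; rewrite /F /G; case: (ltnP (1 + supn x)) => h; last first.
    have hy : (2 ^ m <= 1 + supn y)%N by rewrite (leq_trans h)// leq_add2l.
    by rewrite !logcut_eq0// subrr expr0n mulr0.
  rewrite -mulrA ler_wpM2l//.
  have -> : C ^+ 2 * r x `^ (- b) ^+ 2 / L ^+ 2 * ln (1 + (supn (x - y))%:R / r x) ^+ 2 =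
    (C * r x `^ (- b)) * (C * r x `^ (- b)) * (ln (1 + (supn (x - y))%:R / r x) / L) ^+ 2.
    by field; rewrite gt_eqF.
  have /andP[h1 h2] := logcut_diff R m0 xy.
  rewrite ler_pM ?sqr_ge0 ?mulr_ge0//; last by rewrite lerXn2r ?nnegrE// (le_trans h1 h2).
  have /andP[_ vx] := vC x; have /andP[_ vy] := vC y.
  rewrite ler_pM//; apply: le_trans vy _; rewrite ler_wpM2l// !powRN lef_pV2 ?posrE ?powR_gt0//.
  by rewrite ge0_ler_powR ?nnegrE ?(ltW (r0 _))// lerD2l ler_nat.
have Fsym x y : F x y = F y x.
  by rewrite /F -[x - y]opprB kappaN -[logcut R m x - _]opprB sqrrN [v x * _]mulrC.
have FGG x y : F x y <= G x y + G y x.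
  have [xy|/ltnW yx] := leqP (supn x) (supn y).
    by rewrite -[leLHS]addr0 lerD// FG.
  by rewrite Fsym -[leLHS]add0r lerD// FG.
apply: (@le_trans _ _ (boxsum M (fun x => boxsum M (fun y => G x y + G y x)))).
  by apply: ler_boxsum => x _; apply: ler_boxsum => y _; exact: FGG.
under eq_boxsum do rewrite boxsumD.
rewrite boxsumD [X in _ + X]exchange_boxsum -mulr2n -[_ *+ 2]mulr_natl -mulrA ler_pM2l//.
apply: (@le_trans _ _ (boxsum M (fun x => C ^+ 2 * K / L ^+ 2 *
  (if (1 + supn x < 2 ^ m)%N then (r x ^+ d)^-1 else 0)))).
  apply: ler_boxsum => x _; rewrite /G; case: ifP => _; last first.
    by rewrite /boxsum big1 ?mulr0.
  under eq_boxsum do rewrite mulrCA.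
  rewrite boxsumZ.
  have := boxsum_shift_le M x (g := fun z => kappa sigma z * ln (1 + (supn z)%:R / r x) ^+ 2).
  move=> /(_ (fun z => mulr_ge0 (k0 z) (sqr_ge0 _))) H.
  have {}H := le_trans H (HK _ _ (r1 x)).
  (* The critical exponents meet: [- 2 b - 2 sigma = - d]. *)
  have -> : C ^+ 2 * K / L ^+ 2 * (r x ^+ d)^-1 =
     C ^+ 2 * r x `^ (- b) ^+ 2 / L ^+ 2 * (K * (r x ^+ 2) `^ (- sigma)).
    have -> : (r x ^+ d)^-1 = r x `^ (- b) ^+ 2 * (r x ^+ 2) `^ (- sigma); last by ring.
    rewrite -powR_invn ?(ltW (r0 x))// -!powR_mulrn ?powR_ge0 ?(ltW (r0 x))//.
    rewrite -!powRrM -powRD ?(gt_eqF (r0 x)) ?implybT//.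
    by congr (_ `^ _); rewrite /b; field.
  by rewrite ler_wpM2l// divr_ge0 ?sqr_ge0// mulr_ge0 ?sqr_ge0.
rewrite boxsumZ; apply: le_trans (ler_wpM2l _ (boxsum_shell_le R d M m)) _.
  by rewrite divr_ge0 ?sqr_ge0// mulr_ge0 ?sqr_ge0.
have l20 : 0 < ln 2 :> R by rewrite ln_gt0// ltr1n.
have mp : 0 < m%:R :> R by rewrite ltr0n.
rewrite /L lnXn// -[_ *+ m]mulr_natr le_eqVlt; apply/orP; left; apply/eqP.
by field; rewrite (gt_eqF mp) (gt_eqF l20).
Qed.

End Energy.

(** * Consequences of positivity and of harmonicity *)

Section Comparison.
Variables (R : realType) (d : nat) (sigma : R) (V u : 'rV[int]_d -> R).
Hypotheses (sigma_gt0 : 0 < sigma) (sigma_lt1 : sigma < 1).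
Hypothesis u_dom : frac_domain sigma u.
Hypothesis u_harm : forall x, fracLap sigma u x + V x * u x = 0.
Notation Zd := 'rV[int]_d.
Notation k := (@kappa R d sigma).
Implicit Types x y a : Zd.

Lemma boxsum_kappa_shift_le (K : R) N x : (forall M, boxsum M k <= K) ->
  boxsum N (fun y => k (x - y)) <= K.
Proof.
move=> HK; apply: le_trans (boxsum_shift_le N x _) (HK _) => z; exact: kappa_ge0.
Qed.

(** The value of [limn] carries information only once convergence is known; here the terms are
    absolutely summable, by the total mass of [kappa] and the domain condition. *)
Lemma fracLap_cvg (f : Zd -> R) x : frac_domain sigma f ->
  (fun N => boxsum N (fun y => k (x - y) * (f x - f y))) @ \oo --> fracLap sigma f x.
Proof.
move=> fdom; have [K [_ HK]] := kappa_total d sigma_gt0 sigma_lt1.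
have [B HB] := fdom x.
suff : cvgn (fun N => boxsum N (fun y => k (x - y) * (f x - f y))) by [].
apply: (@boxsum_cvg _ _ _ (K * `|f x| + B)) => N.
apply: (@le_trans _ _ (boxsum N (fun y => k (x - y) * `|f x| + `|k (x - y) * f y|))).
  apply: ler_boxsum => y _; rewrite mulrBr (le_trans (ler_normB _ _))// lerD2r.
  by rewrite normrM ger0_norm ?kappa_ge0.
by rewrite boxsumD boxsumZr lerD// ler_wpM2r// boxsum_kappa_shift_le.
Qed.

Lemma frac_domain_le (f g : Zd -> R) : frac_domain sigma g ->
  (forall x, `|f x| <= `|g x|) -> frac_domain sigma f.
Proof.
move=> gdom fg x; have [B HB] := gdom x; exists B => N; apply: le_trans (HB N).
by apply: ler_boxsum => y _; rewrite !normrM ler_wpM2l.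
Qed.

(* Testing positivity with [|u| * phi]: by harmonicity of [u] the form equals half the
   energy of [phi] with weight [u x * u y], minus the loss
   [k (x - y) * (|u x * u y| - u x * u y) * phi x * phi y]. *)
Lemma positivity_defect_le (phi : Zd -> R) (N0 : nat) (E : R) a b :
  frac_positive sigma V ->
  (forall x, 0 <= phi x <= 1) -> (forall x, (N0 < supn x)%N -> phi x = 0) ->
  (forall M, boxsum M (fun x => boxsum M (fun y =>
     k (x - y) * (`|u x| * `|u y|) * (phi x - phi y) ^+ 2)) <= E) ->
  k (a - b) * (`|u a * u b| - u a * u b) * (phi a * phi b) <= E / 2.
Proof.
move=> Vpos phi01 phi0 HE.
have ph0 x : 0 <= phi x by have /andP[] := phi01 x.
have k0 x : 0 <= k x by apply: kappa_ge0.
pose psi x := `|u x| * phi x.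
have psi0 x : 0 <= psi x by rewrite mulr_ge0.
have psidom : frac_domain sigma psi.
  apply: (frac_domain_le u_dom) => x; rewrite /psi normrM normr_id ler_piMr//.
  by rewrite ger0_norm//; have /andP[] := phi01 x.
(* What remains of the form after [V x * u x] is replaced by [- fracLap sigma u x]: the two
   contributions [u x ^ 2 * phi x ^ 2] cancel. *)
pose T x y := k (x - y) * (u x * u y * phi x ^+ 2 - psi x * psi y).
pose P := boxsum N0 (fun x => fracLap sigma psi x * psi x + V x * psi x ^+ 2).
have P0 : 0 <= P.
  by apply: Vpos => x h; rewrite /psi phi0 ?mulr0// ltnNge; apply/negP => /inboxP/h.
have cP : (fun M => boxsum N0 (fun x => boxsum M (T x))) @ \oo --> P.
  apply: cvgn_sum => j; set x := \row_i _.
  have -> : fracLap sigma psi x * psi x + V x * psi x ^+ 2 =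
      fracLap sigma psi x * psi x - fracLap sigma u x * (u x * phi x ^+ 2).
    have -> : psi x ^+ 2 = u x * (u x * phi x ^+ 2).
      by rewrite /psi exprMn real_normK ?num_real//; ring.
    by have := u_harm x; move=> /eqP; rewrite addr_eq0 => /eqP ->; ring.
  have -> : (fun M => boxsum M (T x)) = (fun M =>
     boxsum M (fun y => k (x - y) * (psi x - psi y)) * psi x -
     boxsum M (fun y => k (x - y) * (u x - u y)) * (u x * phi x ^+ 2)).
    apply/funext => M; rewrite -!boxsumZr -boxsumB; apply: eq_boxsum => y.
    have e : psi x * psi x = u x * u x * phi x ^+ 2.
      by rewrite -expr2 /psi exprMn real_normK ?num_real// expr2.
    rewrite /T; transitivity (k (x - y) * (psi x * psi x - u x * u x * phi x ^+ 2 +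
      (u x * u y * phi x ^+ 2 - psi x * psi y))); last by ring.
    by rewrite e subrr add0r.
  by apply: cvgB; apply: cvgM; [exact: fracLap_cvg|exact: cvg_cst|exact: fracLap_cvg|exact: cvg_cst].
pose Dab := k (a - b) * (`|u a * u b| - u a * u b) * (phi a * phi b).
suff : P <= E / 2 - Dab by rewrite -/Dab; lra.
pose M0 := maxn N0 (maxn (supn a) (supn b)).
pose D x y := k (x - y) * (`|u x * u y| - u x * u y) * (phi x * phi y).
have D0 x y : 0 <= D x y.
  by rewrite /D !mulr_ge0// subr_ge0 ler_norm.
rewrite -(cvg_lim _ cP)//; apply: limr_le; first exact: cvgP cP.
exists M0 => // M /= M0M.
have N0M : (N0 <= M)%N by rewrite (leq_trans _ M0M)// leq_maxl.
have aM : (supn a <= M)%N by rewrite (leq_trans _ M0M)// leq_max leq_maxl orbT.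
have bM : (supn b <= M)%N by rewrite (leq_trans _ M0M)// leq_max leq_maxr orbT.
(* [T x] vanishes outside the support of [phi], so the outer box can be enlarged to [M]; the double
   sum then runs over a symmetric domain and may be symmetrised. *)
rewrite -(@boxsum_support _ _ N0 M)//; last first.
  move=> x xN0; rewrite /boxsum big1// => j _; rewrite /T /psi phi0// expr0n.
  by rewrite !mulr0 mul0r subrr mulr0.
have sym : boxsum M (fun x => boxsum M (T x)) = boxsum M (fun x => boxsum M (fun y => T y x)).
  by rewrite exchange_boxsum.
have E2 : 2 * boxsum M (fun x => boxsum M (T x)) + 2 * boxsum M (fun x => boxsum M (D x)) <= E.
  have -> : 2 * boxsum M (fun x => boxsum M (T x)) =
      boxsum M (fun x => boxsum M (fun y => T x y + T y x)).
    under [RHS]eq_boxsum do rewrite boxsumD.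
    by rewrite boxsumD -sym; ring.
  rewrite -boxsumZ -boxsumD; apply: le_trans (HE M); apply: ler_boxsum => x _.
  rewrite -boxsumZ -boxsumD; apply: ler_boxsum => y _.
  have -> : T x y + T y x + 2 * D x y = k (x - y) * (u x * u y) * (phi x - phi y) ^+ 2.
    by rewrite /T /D /psi -[y - x]opprB kappaN normrM; ring.
  by rewrite ler_wpM2r ?sqr_ge0// ler_wpM2l// -normrM ler_norm.
have : Dab <= boxsum M (fun x => boxsum M (D x)).
  apply: le_trans (boxsum_ge_term (g := fun x => boxsum M (D x)) aM _).
    exact: (boxsum_ge_term (g := D a)).
  by move=> x; apply: boxsum_ge0.
lra.
Qed.

Lemma harmonic_signed_lower (K : R) x a : 0 <= K -> (forall M, boxsum M k <= K) ->
  (forall y z, `|u y * u z| <= u y * u z) -> V x <= 1 ->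
  k (x - a) * `|u a| <= (K + 1) * `|u x|.
Proof.
move=> K0 HK usgn Vx.
have k0 y : 0 <= k y by apply: kappa_ge0.
have [ua|ua] := eqVneq (u a) 0; first by rewrite ua normr0 mulr0 mulr_ge0// addr_ge0.
have na : `|u a| != 0 by rewrite normr_eq0.
pose s := u a / `|u a|.
have su y : s * u y = `|u y|.
  have e : u a * u y = `|u a| * `|u y|.
    by apply/eqP; rewrite -normrM eq_le ler_norm usgn.
  by rewrite /s mulrAC e; field.
have c : (fun N => s * boxsum N (fun y => k (x - y) * (u x - u y))) @ \oo -->
    s * fracLap sigma u x.
  by apply: cvgM; [exact: cvg_cst|exact: fracLap_cvg].
have sV : s * fracLap sigma u x = - V x * `|u x|.
  have /eqP := u_harm x; rewrite addr_eq0 => /eqP ->.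
  by rewrite -su; ring.
rewrite sV in c.
have H : - V x * `|u x| <= K * `|u x| - k (x - a) * `|u a|.
  rewrite -(cvg_lim _ c)//; apply: limr_le; first exact: cvgP c.
  exists (supn a) => // N /= aN; rewrite -boxsumZ.
  have -> : boxsum N (fun y => s * (k (x - y) * (u x - u y))) =
      boxsum N (fun y => k (x - y) * `|u x|) - boxsum N (fun y => k (x - y) * `|u y|).
    rewrite -boxsumB; apply: eq_boxsum => y.
    by rewrite -!su; ring.
  rewrite lerB//; last first.
    apply: (boxsum_ge_term (g := fun y => k (x - y) * `|u y|)) => // y.
    by rewrite mulr_ge0.
  by rewrite boxsumZr ler_wpM2r// boxsum_kappa_shift_le.
have : V x * `|u x| <= 1 * `|u x| by rewrite ler_wpM2r.
lra.
Qed.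

End Comparison.

(** * Constant sign and decay combined into the Liouville property *)

Unset Implicit Arguments.
Local Close Scope classical_set_scope.

Theorem theorem4p1 (R : realType) (d : nat) (sigma : R)
  (V u : 'rV[int]_d -> R) :
  0 < sigma -> sigma < 1 -> sigma < d%:R / 2 ->
  (forall x, V x <= 1) ->
  frac_positive sigma V ->
  frac_harmonic sigma V u ->
  bigO_infty u (fun x => normZ x `^ (sigma - d%:R / 2)) ->
  liminf_infty (fun x => `|u x| * normZ x `^ (d%:R + 2 * sigma)) = 0%E ->
  forall x, u x = 0.
Proof.
move=> s0 s1 sd V1 Vpos [udom uharm] uO ulim a.
have b0 : 0 <= d%:R / 2 - sigma by rewrite subr_ge0 ltW.
have [C [C0 uC]] : exists C : R, 0 <= C /\
    forall x, `|u x| <= C * (1 + (supn x)%:R) `^ (- (d%:R / 2 - sigma)).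
  by apply: bigO_decay => //; rewrite opprB.
have [E HE] : exists E : R, forall m M, (0 < m)%N ->
    boxsum M (fun x => boxsum M (fun y => kappa sigma (x - y) * (`|u x| * `|u y|) *
      (logcut R m x - logcut R m y) ^+ 2)) <= E / m%:R.
  by apply: (logcut_energy s0 s1 sd C0) => x; rewrite normr_ge0 uC.
have [c [c0 Hc]] := kappa_lower d s0 s1.
have [K [K0 HK]] := kappa_total d s0 s1.
have usgn y z : `|u y * u z| <= u y * u z.
  have [->|yz] := eqVneq y z; first by rewrite ger0_norm// -expr2 sqr_ge0.
  have yz0 : y - z != 0 by rewrite subr_eq0.
  have kp : 0 < kappa sigma (y - z).
    apply: lt_le_trans (Hc _ yz0); rewrite mulr_gt0// powR_gt0// ltr0n.
    by rewrite lt0n supn_eq0.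
  have defect m : (0 < m)%N -> kappa sigma (y - z) * (`|u y * u z| - u y * u z) *
      (logcut R m y * logcut R m z) <= E / m%:R / 2.
    move=> m0; apply: (positivity_defect_le (N0 := 2 ^ m) s0 s1 udom uharm) => //.
    - by move=> x; rewrite logcut_ge0 logcut_le1.
    - by move=> x mx; rewrite logcut_eq0// (leq_trans (ltnW mx))// leq_addl.
    - by move=> M; exact: HE.
  rewrite leNgt; apply/negP => lt_yz.
  pose D := kappa sigma (y - z) * (`|u y * u z| - u y * u z).
  have Dp : 0 < D by rewrite mulr_gt0// subr_gt0.
  have l2 : 0 < ln 2 :> R by rewrite ln_gt0// ltr1n.
  (* Beyond the first two terms both cutoffs are at least 1/2, so the defect is at least [D / 4];
     beyond the third, [E / (2 m)] is smaller than that. *)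
  pose B := 2 * ln (1 + (supn y)%:R) / ln 2 + 2 * ln (1 + (supn z)%:R) / ln 2 + 2 * `|E| / D : R.
  have h1 : 0 <= 2 * ln (1 + (supn y)%:R) / ln 2 :> R.
    by rewrite divr_ge0 ?(ltW l2)// mulr_ge0// ln1supn_ge0.
  have h2 : 0 <= 2 * ln (1 + (supn z)%:R) / ln 2 :> R.
    by rewrite divr_ge0 ?(ltW l2)// mulr_ge0// ln1supn_ge0.
  have h3 : 0 <= 2 * `|E| / D by rewrite divr_ge0 ?(ltW Dp)// mulr_ge0.
  have B0 : 0 <= B by rewrite !addr_ge0.
  pose m := (Num.truncn B).+1.
  have Bm : B < m%:R by have /andP[] := truncn_itv B0.
  have m0 : 0 < m%:R :> R by rewrite ltr0n.
  have half x : 2 * ln (1 + (supn x)%:R) / ln 2 <= m%:R :> R -> 2^-1 <= logcut R m x.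
    move=> hx; rewrite /logcut le_max; apply/orP; right.
    have : ln (1 + (supn x)%:R) / ln (2 ^+ m) <= 2^-1 :> R.
      rewrite ler_pdivrMr ?ln_pow2_gt0// lnXn// -[_ *+ m]mulr_natr.
      by move: hx; rewrite ler_pdivrMr//; lra.
    lra.
  have hy : 2^-1 <= logcut R m y by apply: half; rewrite /B in Bm; lra.
  have hz : 2^-1 <= logcut R m z by apply: half; rewrite /B in Bm; lra.
  have := defect m isT; rewrite -/D.
  have : D * (2^-1 * 2^-1) <= D * (logcut R m y * logcut R m z).
    by rewrite ler_wpM2l ?(ltW Dp)// ler_pM.
  have : E / m%:R / 2 < D / 4.
    have : 2 * `|E| / D < m%:R by rewrite /B in Bm; lra.
    rewrite ltr_pdivrMr// => hE.
    have : E / m%:R < D / 2.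
      by rewrite ltr_pdivrMr//; have := ler_norm E; lra.
    lra.
  lra.
apply/eqP; apply: contraT => ua.
have ua0 : 0 < `|u a| by rewrite normr_gt0.
pose e := d%:R + 2 * sigma.
have e0 : 0 <= e by rewrite addr_ge0// mulr_ge0// ltW.
(* For [supn x > supn a] one has [supn (x - a) <= 2 * normZ x], whence the factor [2 ^ (- e)];
   [K + 1] comes from [harmonic_signed_lower]. *)
pose c' := c * 2 `^ (- e) * `|u a| / (K + 1).
have K1 : 0 < K + 1 by lra.
have c'0 : 0 < c' by rewrite divr_gt0// !mulr_gt0// powR_gt0.
have low x : (supn a < supn x)%N -> c' <= `|u x| * normZ x `^ e.
  move=> ax.
  have xa : x - a != 0 by rewrite subr_eq0; apply: contraTneq ax => ->; rewrite ltnn.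
  have H := harmonic_signed_lower s0 s1 udom uharm a K0 HK usgn (V1 x).
  have sx : 0 < (supn x)%:R :> R by rewrite ltr0n (leq_ltn_trans _ ax).
  have sxa : 0 < (supn (x - a))%:R :> R by rewrite ltr0n lt0n supn_eq0.
  have nx : 0 < normZ x :> R := lt_le_trans sx (supn_le_normZ R x).
  have p1 : 2 `^ (- e) * normZ x `^ (- e) <= (supn (x - a))%:R `^ (- e) :> R.
    rewrite -powRM ?(ltW nx)// !powRN lef_pV2 ?posrE ?powR_gt0 ?mulr_gt0//.
    rewrite ge0_ler_powR ?nnegrE ?(ltW sxa) ?mulr_ge0 ?(ltW nx)//.
    have : (supn (x - a))%:R <= (supn x)%:R + (supn a)%:R :> R.
      by rewrite -natrD ler_nat -[supn a]supnN supnD.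
    have : (supn a)%:R <= (supn x)%:R :> R by rewrite ler_nat ltnW.
    have := supn_le_normZ R x; lra.
  rewrite /c' ler_pdivrMr//.
  have kl := Hc _ xa; rewrite -/e in kl.
  have nxe : 0 < normZ x `^ e :> R by rewrite powR_gt0.
  have p2 : c * 2 `^ (- e) <= kappa sigma (x - a) * normZ x `^ e.
    rewrite -ler_pdivrMr// -powRN; apply: le_trans kl.
    by rewrite -mulrA ler_wpM2l// ltW.
  apply: (@le_trans _ _ (kappa sigma (x - a) * normZ x `^ e * `|u a|)).
    by rewrite ler_wpM2r.
  rewrite mulrAC; have -> : `|u x| * normZ x `^ e * (K + 1) = (K + 1) * `|u x| * normZ x `^ e.
    by ring.
  by rewrite ler_wpM2r// ltW.
have d0 : (0 < d)%N by rewrite lt0n; apply: contraTneq sd => ->; rewrite mul0r -leNgt ltW.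
have : (c'%:E <= 0)%E.
  rewrite -ulim /liminf_infty.
  (* This radius forces [supn x > supn a], since [normZ x <= d * supn x] and [d > 0]; a single
     radius already bounds the supremum over radii from below. *)
  apply: (@le_trans _ _ (ereal_inf [set (`|u x| * normZ x `^ e)%:E | x in
    [set x : 'rV[int]_d | d%:R * (supn a).+1%:R <= normZ x]])).
    apply: le_ereal_inf_tmp => _ [x /= hx <-]; rewrite lee_fin low//.
    have := le_trans hx (normZ_le_supn R x).
    by rewrite ler_pM2l ?ltr0n// ler_nat.
  by apply: ereal_sup_ubound; exists (d%:R * (supn a).+1%:R).
by rewrite lee_fin leNgt c'0.
Qed.
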